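(* There exist states that are $G$-incompatible (for a network $G$, with this incompatibility witnessed by an inflation of $G$), but for which this incompatibility is not distribution-witnessable with respect to the same inflation of $G$.
   Context: A network $G$ is a directed acyclic graph whose nodes are divided into latent nodes, which have no parents, and visible nodes, all of whose parents are latent. To each visible node $A$ is associated a finite-dimensional Hilbert space $\mathcal{H}_A$. A state (positive semidefinite, unit trace) $\rho$ on $\bigotimes_A\mathcal{H}_A$ is $G$-compatible if there exist: for each latent node $L$, a finite-dimensional Hilbert space $\mathcal{H}_L=\bigotimes_{A}\mathcal{H}_{L^{(A)}}$ (one factor for each child $A$ of $L$) and a state $\rho_L$ on it; and for each visible node $A$, a quantum channel (completely positive trace-preserving map) $\mathcal{E}_A$ from the operators on $\bigotimes_{L\in\mathrm{Pa}(A)}\mathcal{H}_{L^{(A)}}$ to those on $\mathcal{H}_A$, such that $\rho=(\bigotimes_A\mathcal{E}_A)(\bigotimes_L\rho_L)$. Otherwise $\rho$ is $G$-incompatible. A family of states on subsets of the visible systems is compatible with $G$ if its members are the marginals (partial traces) of a single $G$-compatible state. A joint probability distribution over outcomes is regarded as a state diagonal in a product basis, and its $G$-compatibility is understood accordingly (latent systems may be quantum). An inflation $G'$ of $G$ is a directed acyclic graph each of whose nodes is a labelled copy of a node of $G$ (every node of $G$ having at least one copy), such that the ancestral subgraph of each node of $G'$ becomes, upon dropping the copy labels, the ancestral subgraph in $G$ of the corresponding node. Attention is restricted to nonfanout inflations, i.e. those in which no latent node has two children that are copies of the same visible node. A set $U'$ of visible nodes of $G'$ is injectable if dropping copy labels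 maps $U'$ bijectively to a set $U$ of visible nodes of $G$ and maps the ancestral subgraph of $U'$ in $G'$ isomorphically to that of $U$ in $G$; $U$ is called its image. A set $Y'$ of visible nodes of $G'$ is expressible if it is a union of injectable sets $U'_{(1)},\dots,U'_{(y)}$ whose ancestral subgraphs in $G'$ are pairwise disjoint. Given a state $\rho$ on the visible nodes of $G$ with marginals $\rho_U$, put $\sigma_{Y'}:=\bigotimes_j\rho_{U_{(j)}}$, with $U_{(j)}$ the image of $U'_{(j)}$. If $\rho$ is $G$-compatible, then the family of all $\sigma_{Y'}$ ($Y'$ expressible) is compatible with $G'$, and hence satisfies every causal compatibility inequality for $G'$ (an inequality on a family of states on sets of visible nodes that is satisfied by every such family compatible with $G'$). The $G$-incompatibility of $\rho$ is witnessed by the inflation $G'$ when it is established by a violation of such an inequality by states $\sigma_{Y'}$; the same terminology applies to distributions. The $G$-incompatibility of a state is distribution-witnessable when it can be proved by leveraging the $G$-incompatibility of a distribution obtained from the state by local measurements (one on each visible system). It is distribution-witnessable with respect to the inflation $G'$ if there is some choice of local measurements yielding a distribution whose $G$-incompatibility is witnessed by $G'$. *)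

(* Defs.v *)
(* The scalars are the complex numbers R[i] over R : realType.
   A finite-dimensional Hilbert space is given by the finite type T of labels of
   an orthonormal basis, i.e. it is C^T; operators on it are square matrices of
   size #|T|. *)
From HB Require Import structures.
From mathcomp Require Import all_boot all_order all_algebra.
From mathcomp Require Import reals complex.
Set Implicit Arguments.
Unset Strict Implicit.
Unset Printing Implicit Defensive.
Import Order.TTheory GRing.Theory Num.Theory.
Local Open Scope ring_scope.

(* ---------- Finite-dimensional quantum theory ---------- *)

Definition op (R : realType) (T : finType) := 'M[R[i]]_#|T|.

Definition coef (R : realType) (T : finType) (M : op R T) (s t : T) : R[i] :=
  M (enum_rank s) (enum_rank t).

Definition mkop (R : realType) (T : finType) (f : T -> T -> R[i]) : op R T :=
  \matrix_(i, j) f (enum_val i) (enum_val j).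

Definition ketbra (R : realType) (T : finType) (s t : T) : op R T :=
  delta_mx (enum_rank s) (enum_rank t).

(* In R[i], 0 <= z says that z is real and nonnegative. *)
Definition psd (R : realType) (T : finType) (M : op R T) : Prop :=
  forall v : 'cV[R[i]]_#|T|, 0 <= ((map_mx Num.conj v)^T *m M *m v) 0 0.

Definition is_state (R : realType) (T : finType) (M : op R T) : Prop :=
  psd M /\ \tr M = 1.

(* id_K (x) E : the map E acts on each T-block of X. *)
Definition ampliation (R : realType) (K T S : finType) (E : op R T -> op R S)
    (X : op R (K * T)%type) : op R (K * S)%type :=
  mkop (fun p q =>
    coef (E (mkop (fun x y => coef X (p.1, x) (q.1, y)))) p.2 q.2).

Definition completely_positive (R : realType) (T S : finType)
    (E : op R T -> op R S) : Prop :=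
  forall (K : finType) (X : op R (K * T)%type), psd X -> psd (ampliation E X).

Definition trace_preserving (R : realType) (T S : finType)
    (E : op R T -> op R S) : Prop :=
  forall X : op R T, \tr (E X) = \tr X.

Definition is_channel (R : realType) (T S : finType)
    (E : {linear op R T -> op R S}) : Prop :=
  completely_positive E /\ trace_preserving E.

Definition is_povm (R : realType) (T K : finType) (E : K -> op R T) : Prop :=
  (forall k, psd (E k)) /\ \sum_k E k = 1%:M.

(* ---------- Tensor products ---------- *)

(* Product basis of the tensor product of the C^(h i). *)
Definition tbasis (I : finType) (h : I -> finType) : finType :=
  {dffun forall i : I, h i}.

Definition reindex_tb (I J : finType) (h : I -> finType) (f : J -> I)
    (x : tbasis h) : tbasis (fun j => h (f j)) :=
  finfun (fun j => x (f j)).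

(* Tensor product of the operators M j on C^(T j). The basis X of the total
   space comes with the projections r j that read off the label of the j-th
   factor. *)
Definition tensor_op (R : realType) (J X : finType) (T : J -> finType)
    (r : forall j, X -> T j) (M : forall j, op R (T j)) : op R X :=
  mkop (fun x y => \prod_j coef (M j) (r j x) (r j y)).

(* Tensor product of the linear maps E j, determined by its values on the
   matrix units: |x><y| = (x)_j |x_j><y_j| is sent to (x)_j E j (|x_j><y_j|). *)
Definition tensor_map (R : realType) (J X Z : finType) (T S : J -> finType)
    (r : forall j, X -> T j) (q : forall j, Z -> S j)
    (E : forall j, op R (T j) -> op R (S j)) (M : op R X) : op R Z :=
  \sum_x \sum_y
    coef M x y *: tensor_op q (fun j => E j (ketbra R (r j x) (r j y))).

(* For an injective f : J -> I, the partial trace over the factors outside the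
   image of f; the remaining factor f j is relabelled j. *)
Definition marginal (R : realType) (I J : finType) (h : I -> finType)
    (f : J -> I) (rho : op R (tbasis h)) : op R (tbasis (fun j => h (f j))) :=
  mkop (fun s t =>
    \sum_(x | reindex_tb f x == s)
      \sum_(y | (reindex_tb f y == t) &&
                [forall i, (i \notin codom f) ==> (x i == y i)])
        coef rho x y).

(* ---------- Networks ---------- *)

(* All arrows go from a latent to a visible node, hence acyclicity. *)
Record network := Network {
  lat : finType;
  vis : finType;
  edge : lat -> vis -> bool }.

Definition node (G : network) : finType := (lat G + vis G)%type.

Definition arc (G : network) : rel (node G) := fun x y =>
  match x, y with
  | inl L, inr A => edge L A
  | _, _ => false
  end.

Definition ancestral (G : network) (U : {set node G}) : {set node G} :=
  [set x | [exists u in U, connect (@arc G) x u]].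

Definition vis_nodes (G : network) (U : {set vis G}) : {set node G} :=
  [set inr A | A in U].

Definition children (G : network) (L : lat G) : finType :=
  {A : vis G | edge L A}.
Definition parents (G : network) (A : vis G) : finType :=
  {L : lat G | edge L A}.
Definition edges (G : network) : finType :=
  {e : lat G * vis G | edge e.1 e.2}.

Definition edge_to_child (G : network) (L : lat G) (A : children L) : edges G :=
  exist (fun e : lat G * vis G => edge e.1 e.2) (L, val A) (valP A).
Definition edge_from_parent (G : network) (A : vis G) (L : parents A) :
    edges G :=
  exist (fun e : lat G * vis G => edge e.1 e.2) (val L, A) (valP L).

(* k e is the basis of the factor H_(L^(A)) carried by the edge e = (L, A). *)
Definition compatible (R : realType) (G : network) (h : vis G -> finType)
    (rho : op R (tbasis h)) : Prop :=
  exists (k : edges G -> finType)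
         (rhoL : forall L, op R (tbasis (fun A => k (@edge_to_child G L A))))
         (E : forall A,
            {linear op R (tbasis (fun L => k (@edge_from_parent G A L))) ->
                    op R (h A)}),
    [/\ forall L, is_state (rhoL L),
        forall A, is_channel (E A)
      & rho = tensor_map
                (fun A (x : tbasis k) => reindex_tb (@edge_from_parent G A) x)
                (fun A (s : tbasis h) => s A)
                (fun A => E A)
                (tensor_op
                   (fun L (x : tbasis k) => reindex_tb (@edge_to_child G L) x)
                   rhoL)].

(* Operators on the visible systems in Y. *)
Definition op_on (R : realType) (G : network) (h : vis G -> finType)
    (Y : {set vis G}) :=
  op R (tbasis (fun a : {a : vis G | a \in Y} => h (val a))).

Definition family_compatible (R : realType) (G : network) (h : vis G -> finType)
    (I : finType) (Y : I -> {set vis G}) (fam : forall i, op_on R h (Y i)) :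
    Prop :=
  exists tau : op R (tbasis h),
    compatible tau /\
    forall i, fam i = marginal (fun a : {a : vis G | a \in Y i} => val a) tau.

(* The inequality F fam <= 0 on families of states on the sets Y i, for a real
   function F on which no regularity is imposed. *)
Definition causal_compatibility_inequality (R : realType) (G : network)
    (h : vis G -> finType) (I : finType) (Y : I -> {set vis G})
    (F : (forall i, op_on R h (Y i)) -> R) : Prop :=
  forall fam : forall i, op_on R h (Y i), family_compatible fam -> F fam <= 0.
Arguments causal_compatibility_inequality {R} G h {I} Y F.

(* ---------- Inflations ---------- *)

Definition drop_node (G' G : network) (dl : lat G' -> lat G)
    (dv : vis G' -> vis G) (x : node G') : node G :=
  match x with
  | inl L => inl (dl L)
  | inr A => inr (dv A)
  end.

(* pi restricts to an isomorphism from the ancestral subgraph of U to that of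
   its image. *)
Definition ancestral_iso (G' G : network) (pi : node G' -> node G)
    (U : {set node G'}) : Prop :=
  [/\ {in ancestral U &, injective pi},
      pi @: ancestral U = ancestral (pi @: U)
    & {in ancestral U &, forall x y, arc x y = arc (pi x) (pi y)}].

(* The copies of a node of G are its preimages under the dropping maps. That
   G' is a network over the latent and visible copies loses nothing: by
   the ancestral condition a copy of a latent node has no parents, and the
   parents of a copy of a visible node are copies of latent nodes. *)
Record inflation (G : network) := Inflation {
  inf_net :> network;
  drop_lat : lat inf_net -> lat G;
  drop_vis : vis inf_net -> vis G;
  drop_surj : forall x : node G,
    exists x' : node inf_net, drop_node drop_lat drop_vis x' = x;
  drop_ancestral : forall x' : node inf_net,
    ancestral_iso (drop_node drop_lat drop_vis) [set x'] }.

Definition nonfanout (G : network) (G' : inflation G) : Prop :=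
  forall (L : lat G') (A B : vis G'),
    edge L A -> edge L B -> drop_vis A = drop_vis B -> A = B.

Definition injectable (G : network) (G' : inflation G) (U : {set vis G'}) :
    Prop :=
  {in U &, injective (@drop_vis G G')} /\
  ancestral_iso (drop_node (@drop_lat G G') (@drop_vis G G')) (vis_nodes U).

(* An expressible set of G' together with a decomposition into injectable sets.
   The decomposition is recorded because, when rho is not G-compatible, sigma
   may depend on it. *)
Record expressible (G : network) (G' : inflation G) := Expressible {
  arity : nat;
  part : 'I_arity -> {set vis G'};
  part_injectable : forall j, injectable (part j);
  part_disjoint : forall j k, j != k ->
    [disjoint ancestral (vis_nodes (part j)) & ancestral (vis_nodes (part k))] }.
Arguments part {G G'} e j.

Definition expr_set (G : network) (G' : inflation G) (Y : expressible G') :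
    {set vis G'} :=
  \bigcup_j part Y j.

Lemma part_sub (G : network) (G' : inflation G) (Y : expressible G')
    (j : 'I_(arity Y)) (a : {a : vis G' | a \in part Y j}) :
  val a \in expr_set Y.
Proof. by apply: (subsetP (bigcup_sup j _)) => //; exact: valP. Qed.

Definition part_incl (G : network) (G' : inflation G) (Y : expressible G')
    (j : 'I_(arity Y)) (a : {a : vis G' | a \in part Y j}) :
    {a : vis G' | a \in expr_set Y} :=
  exist (fun a => a \in expr_set Y) (val a) (part_sub a).

Definition copy_basis (G : network) (G' : inflation G) (h : vis G -> finType) :
    vis G' -> finType :=
  fun a => h (drop_vis a).

(* The j-th tensor factor is the marginal of rho on the image of part Y j,
   relabelled by the elements of part Y j. *)
Definition sigma (R : realType) (G : network) (G' : inflation G)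
    (h : vis G -> finType) (rho : op R (tbasis h)) (Y : expressible G') :
    op_on R (@copy_basis G G' h) (expr_set Y) :=
  tensor_op
    (fun j x => reindex_tb (@part_incl G G' Y j) x)
    (fun j => marginal (fun a : {a : vis G' | a \in part Y j} =>
                          drop_vis (val a)) rho).

Definition witnessed (R : realType) (G : network) (G' : inflation G)
    (h : vis G -> finType) (rho : op R (tbasis h)) : Prop :=
  exists (I : finType) (Y : I -> expressible G')
         (F : (forall i, op_on R (@copy_basis G G' h) (expr_set (Y i))) -> R),
    causal_compatibility_inequality G' (@copy_basis G G' h)
      (fun i => expr_set (Y i)) F /\
    0 < F (fun i => sigma rho (Y i)).

(* ---------- Local measurements ---------- *)

Definition outcome_prob (R : realType) (G : network) (h o : vis G -> finType)
    (E : forall A, o A -> op R (h A)) (rho : op R (tbasis h)) (k : tbasis o) :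
    R[i] :=
  \tr (tensor_op (fun A (x : tbasis h) => x A) (fun A => E A (k A)) *m rho).

Definition diagonal_state (R : realType) (T : finType) (P : T -> R[i]) :
    op R T :=
  mkop (fun s t => if s == t then P s else 0).

Definition distribution_witnessable (R : realType) (G : network)
    (G' : inflation G) (h : vis G -> finType) (rho : op R (tbasis h)) : Prop :=
  exists (o : vis G -> finType) (E : forall A, o A -> op R (h A)),
    (forall A, is_povm (E A)) /\
    witnessed G' (diagonal_state (outcome_prob E rho)).

(* Main.v *)
(* The network is the triangle, with visible nodes A, B, C, and the inflation
   cuts the source shared by A and C into two independent ones. A family of
   states on AB, BC, AC with rho_AC = rho_A (x) rho_C is all that the inflation
   sees.

   The state is rho = 1/8 (1 + 1/2 sum_(pairs) (XX + YY)). On the expressible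
   sets its inflated family is that of the operator
   tau = 1/8 (1 + 1/2 ((XX + YY)_AB + (XX + YY)_BC)), and no positive
   operator has the marginals of tau: the sum of the expectations in
   |100> - |010> + |001> and in its bit flip involves only two-body marginals,
   and equals -1/4 on tau. If rho were compatible with the triangle, replacing the AC
   source by the product of its marginals would produce such a positive
   operator.

   After local measurements tau becomes the table
   p_A p_B p_C + 2 p_C Re (w_A w_B^* ) + 2 p_A Re (w_B w_C^* ) with |w| <= p / 2,
   which is nonnegative, and in which A and C are independent. Hence it is
   realised on the inflation by classical sources telling B the outcomes of A
   and of C. *)
From HB Require Import structures.
From mathcomp Require Import all_boot all_order all_algebra.
From mathcomp Require Import reals complex.
From mathcomp Require Import boolp.
From mathcomp Require Import ring.
Require Import Defs.
Set Implicit Arguments.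
Unset Strict Implicit.
Unset Printing Implicit Defensive.
Import Order.TTheory GRing.Theory Num.Theory.
Local Open Scope ring_scope.

(** * Operators by their coefficients, sums over product bases *)

Lemma coef_mkop (R : realType) (T : finType) (f : T -> T -> R[i]) s t :
  coef (mkop f) s t = f s t.
Proof. by rewrite /coef mxE !enum_rankK. Qed.

Lemma opP (R : realType) (T : finType) (M N : op R T) :
  (forall s t, coef M s t = coef N s t) -> M = N.
Proof.
move=> e; apply/matrixP=> i j.
by have := e (enum_val i) (enum_val j); rewrite /coef !enum_valK.
Qed.

Lemma coef_ketbra (R : realType) (T : finType) (s t x y : T) :
  coef (ketbra R s t) x y = ((x == s) && (y == t))%:R.
Proof. by rewrite /coef mxE !(inj_eq enum_rank_inj). Qed.

Lemma op_coef_sum (R : realType) (T I : finType) (P : pred I) (F : I -> op R T) x y :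
  coef (\sum_(i | P i) F i) x y = \sum_(i | P i) coef (F i) x y.
Proof. by rewrite /coef summxE. Qed.

Lemma op_coefZ (R : realType) (T : finType) c (M : op R T) x y :
  coef (c *: M) x y = c * coef M x y.
Proof. by rewrite /coef mxE. Qed.

Lemma op_coefD (R : realType) (T : finType) (M N : op R T) x y :
  coef (M + N) x y = coef M x y + coef N x y.
Proof. by rewrite /coef mxE. Qed.

Lemma sum_enum_rank (V : nmodType) (T : finType) (F : 'I_#|T| -> V) :
  \sum_i F i = \sum_(x : T) F (enum_rank x).
Proof. exact: (reindex _ (onW_bij _ (@enum_rank_bij T))). Qed.

Lemma mxtrace_coef (R : realType) (T : finType) (M : op R T) :
  \tr M = \sum_x coef M x x.
Proof. by rewrite /mxtrace sum_enum_rank. Qed.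

Lemma mxtrace_mul_coef (R : realType) (T : finType) (M N : op R T) :
  \tr (M *m N) = \sum_x \sum_y coef M x y * coef N y x.
Proof.
rewrite /mxtrace sum_enum_rank; apply: eq_bigr => x _.
by rewrite mxE sum_enum_rank.
Qed.

(** Distributivity with dependent choices. Each inner sum is moved to the tagged union of the [h i],
    where nondependent distributivity applies; choice functions that respect the tags are identified
    with dependent functions by [fprod_of_dffun]. *)
Lemma sum_dffun_prod (C : comPzSemiRingType) (I : finType) (h : I -> finType)
    (F : forall i, h i -> C) :
  \sum_(x : tbasis h) \prod_i F i (x i) = \prod_i \sum_k F i k.
Proof.
under [RHS]eq_bigr => i _ do rewrite big_tag.
rewrite bigA_distr_big_dep /=.
have := @big_fprod C 0 1 *%R +%R I h (fun i => [ffun k => F i k]).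
set RH := (X in _ = X -> _) => E.
transitivity RH; last first.
  apply: eq_bigr => g gf; apply: eq_bigr => i _.
  rewrite /untag; case: eqP => // e; by rewrite ffunE.
rewrite -E (reindex (@fprod_of_dffun I h)); last first.
  exact/onW_bij/fprod_of_dffun_bij.
apply: eq_bigr => x _; apply: eq_bigr => i _.
by rewrite ffunE fprodE.
Qed.

Lemma sum2_dffun_prod (C : comPzSemiRingType) (I : finType) (h : I -> finType)
    (F : forall i, h i -> h i -> C) :
  \sum_(x : tbasis h) \sum_(y : tbasis h) \prod_i F i (x i) (y i) =
  \prod_i \sum_k \sum_l F i k l.
Proof.
rewrite -sum_dffun_prod; apply: eq_bigr => x _.
by rewrite (sum_dffun_prod (fun i => F i (x i))).
Qed.

Lemma prodr_forall (C : comPzSemiRingType) (I : finType) (P : pred I) :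
  \prod_i (P i)%:R = [forall i, P i]%:R :> C.
Proof.
case: forallP => [Pall|/forallP]; first by rewrite big1 // => i _; rewrite Pall.
by rewrite negb_forall => /existsP[i /negPf Pi]; rewrite (bigD1 i) //= Pi mul0r.
Qed.

Lemma dffun_eqE (I : finType) (h : I -> finType) (x y : tbasis h) :
  (x == y) = [forall i, x i == y i].
Proof.
apply/eqP/forallP => [-> //|e]; apply/ffunP => i; exact/eqP.
Qed.

Lemma tbasisP (I : finType) (h : I -> finType) (x y : tbasis h) :
  (forall i, x i = y i) -> x = y.
Proof. by move=> e; apply/ffunP. Qed.

Lemma reindex_tbE (I J : finType) (h : I -> finType) (f : J -> I)
    (x : tbasis h) j : reindex_tb f x j = x (f j).
Proof. by rewrite ffunE. Qed.

Definition mix (I : finType) (h : I -> finType) (S : {set I}) (x y : tbasis h) :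
    tbasis h :=
  finfun (fun i => if i \in S then x i else y i).

Lemma mixE (I : finType) (h : I -> finType) (S : {set I}) (x y : tbasis h) i :
  mix S x y i = if i \in S then x i else y i.
Proof. by rewrite ffunE. Qed.

(** A right inverse of [reindex_tb f] for injective [f]. It lets the coefficients of a marginal be
    indexed by labels of all factors. *)
Definition extend (I J : finType) (h : I -> finType) (f : J -> I)
    (d : tbasis h) (s : tbasis (fun j => h (f j))) : tbasis h :=
  finfun (fun i => match pickP (fun j => f j == i) with
                   | Pick j e => eq_rect (f j) (fun i => h i) (s j) i (eqP e)
                   | Nopick _ => d i
                   end).

Lemma extendK (I J : finType) (h : I -> finType) (f : J -> I) (d : tbasis h) :
  injective f ->
  cancel (@extend I J h f d) (@reindex_tb I J h f).
Proof.
move=> f_inj s; apply: tbasisP => j; rewrite reindex_tbE ffunE.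
case: pickP => [j' e|/(_ j)]; last by rewrite eqxx.
(* Once [j'] and [j] are identified, the transport is along a proof of an equality [x = x], trivial
   by uniqueness of identity proofs. *)
move: (eqP e) => e'; have jj' := f_inj _ _ e'.
by case: _ / jj' e e' => _ e'; rewrite (eq_axiomK e').
Qed.

Lemma extend_out (I J : finType) (h : I -> finType) (f : J -> I) (d : tbasis h)
    (s : tbasis (fun j => h (f j))) i :
  i \notin codom f -> extend d s i = d i.
Proof.
move=> fi; rewrite ffunE; case: pickP => // j e.
by rewrite -(eqP e) codom_f in fi.
Qed.

Lemma reindex_tb_eq (I J : finType) (h : I -> finType) (f : J -> I)
    (x y : tbasis h) :
  (reindex_tb f x == reindex_tb f y) = [forall i, (i \in codom f) ==> (x i == y i)].
Proof.
apply/eqP/forallP => [e i|e].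
  apply/implyP => /codomP[j ->]; apply/eqP.
  by have := congr1 (fun z : tbasis _ => z j) e; rewrite !reindex_tbE.
apply: tbasisP => j; rewrite !reindex_tbE; apply/eqP.
by have := e (f j); rewrite codom_f.
Qed.

(* Vectors equal to the default d off S represent the elements of the product
   basis of the factors in S. *)
Definition supp (I : finType) (h : I -> finType) (d : tbasis h) (S : {set I})
    (x : tbasis h) : bool := [forall i, (i \notin S) ==> (x i == d i)].

Lemma suppP (I : finType) (h : I -> finType) (d : tbasis h) (S : {set I})
    (x : tbasis h) :
  reflect (forall i, i \notin S -> x i = d i) (supp d S x).
Proof.
apply: (iffP forallP) => e i; first by move=> iS; have := e i; rewrite iS => /eqP.
by apply/implyP => /e ->.
Qed.

Lemma sum_mix (V : nmodType) (I : finType) (h : I -> finType) (d : tbasis h)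
    (S S' : {set I}) (F : tbasis h -> V) :
  [disjoint S & S'] ->
  \sum_(x | supp d (S :|: S') x) F x =
  \sum_(z | supp d S z) \sum_(z' | supp d S' z') F (mix S z z').
Proof.
move=> dS; rewrite pair_big_dep /=.
rewrite (reindex_onto (fun p : tbasis h * tbasis h => mix S p.1 p.2)
           (fun x => (mix S x d, mix S' x d))) /=; last first.
  move=> x /suppP xd; apply: tbasisP => i; rewrite !mixE.
  have [//|iS] := boolP (i \in S); have [//|iS'] := boolP (i \in S').
  by rewrite xd // inE negb_or iS.
apply: eq_bigl => -[z z'] /=; apply/idP/idP.
  move=> /andP[/suppP H /eqP [e1 e2]]; apply/andP; split; apply/suppP => i iS.
    by rewrite -e1 mixE (negPf iS).
  by rewrite -e2 mixE (negPf iS).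
move=> /andP[/suppP H1 /suppP H2]; apply/andP; split.
  apply/suppP => i; rewrite inE negb_or => /andP[iS iS'].
  by rewrite mixE (negPf iS) H2.
apply/eqP; congr pair; apply: tbasisP => i; rewrite !mixE.
  by have [|/H1] := boolP (i \in S).
have [iS'|/H2 //] := boolP (i \in S').
by rewrite (disjointFl dS iS').
Qed.

Lemma supp_setT (I : finType) (h : I -> finType) (d x : tbasis h) :
  supp d setT x.
Proof. by apply/suppP => i; rewrite inE. Qed.

Lemma sum_mixC (V : nmodType) (I : finType) (h : I -> finType) (d : tbasis h)
    (S : {set I}) (F : tbasis h -> V) :
  \sum_x F x = \sum_(z | supp d S z) \sum_(z' | supp d (~: S) z') F (mix S z z').
Proof.
rewrite -sum_mix; last by rewrite -setI_eq0 setICr.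
by apply: eq_bigl => x; rewrite setUCr supp_setT.
Qed.

Lemma sum_reindex_tb (V : nmodType) (I J : finType) (h : I -> finType)
    (f : J -> I) (d : tbasis h) (F : tbasis (fun j => h (f j)) -> V) :
  injective f ->
  \sum_u F u = \sum_(x | supp d [set i in codom f] x) F (reindex_tb f x).
Proof.
move=> f_inj; rewrite (reindex_onto (@reindex_tb I J h f) (extend d)) /=; last first.
  by move=> u _; rewrite extendK.
apply: eq_bigl => x; apply/eqP/suppP => [<- i|xd].
  by rewrite inE => /extend_out.
apply: tbasisP => i; have [/codomP[j ->]|iS] := boolP (i \in codom f).
  by rewrite -(reindex_tbE f) extendK // reindex_tbE.
by rewrite extend_out ?xd ?inE.
Qed.

(** The inner sum of [marginal] has a single term: the column label is that of [y] on the kept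
    factors and that of [z] on the traced ones. *)
Lemma coef_marginal (R : realType) (I J : finType) (h : I -> finType)
    (f : J -> I) (rho : op R (tbasis h)) (x y : tbasis h) :
  coef (marginal f rho) (reindex_tb f x) (reindex_tb f y) =
  \sum_(z : tbasis h | [forall i, (i \in codom f) ==> (z i == x i)])
     coef rho z (mix [set i in codom f] y z).
Proof.
rewrite coef_mkop; apply: eq_big => [z|z _]; first by rewrite reindex_tb_eq.
rewrite (big_pred1 (mix [set i in codom f] y z)) // => u /=.
rewrite reindex_tb_eq; apply/andP/eqP => [[/forallP H1 /forallP H2]|->].
  apply: tbasisP => i; rewrite mixE inE; case: ifP => fi.
    by have := H1 i; rewrite fi => /eqP.
  by have := H2 i; rewrite fi => /eqP.
by split; apply/forallP => i; rewrite mixE inE; case: (i \in codom f); rewrite /= ?eqxx.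
Qed.

Lemma coef_marginal_prod (R : realType) (I J : finType) (h : I -> finType)
    (f : J -> I) (g : forall i, h i -> h i -> R[i]) (x y : tbasis h) :
  coef (marginal f (mkop (fun x y : tbasis h => \prod_i g i (x i) (y i))))
    (reindex_tb f x) (reindex_tb f y) =
  \prod_i (if i \in codom f then g i (x i) (y i) else \sum_k g i k k).
Proof.
rewrite coef_marginal big_mkcond /=.
(* [F] puts the constraint on [z] and the choice of the column label into one factor per site, so
   that the sum over [z] distributes. *)
pose F i k := ((i \in codom f) ==> (k == x i))%:R *
  g i k (if i \in codom f then y i else k).
transitivity (\sum_(z : tbasis h) \prod_i F i (z i)).
  apply: eq_bigr => z _; rewrite coef_mkop big_split /= prodr_forall.
  case: ifP => _; rewrite ?mul0r // mul1r; apply: eq_bigr => i _.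
  by rewrite mixE inE.
rewrite sum_dffun_prod; apply: eq_bigr => i _; rewrite /F.
case: ifP => fi; last by apply: eq_bigr => k _; rewrite mul1r.
rewrite (bigD1 (x i)) //= eqxx mul1r big1 ?addr0 // => k /negPf ->.
by rewrite mul0r.
Qed.

(** * Positive semidefinite kernels *)

(** Indexed by the finite type itself rather than by ordinals, so that kernels can be pulled back
    along maps of labels and multiplied pointwise. *)
Definition psd_kernel (R : realType) (X : finType) (K : X -> X -> R[i]) : Prop :=
  forall v : X -> R[i], 0 <= \sum_x \sum_y (v x)^* * K x y * v y.

Lemma psdP (R : realType) (T : finType) (M : op R T) :
  psd M <-> psd_kernel (coef M).
Proof.
have E (w : 'cV[R[i]]_#|T|) (v : T -> R[i]) : (forall x, v x = w (enum_rank x) 0) ->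
    ((map_mx Num.conj w)^T *m M *m w) 0 0 =
    \sum_x \sum_y (v x)^* * coef M x y * v y.
  move=> vw; rewrite exchange_big mxE sum_enum_rank; apply: eq_bigr => y _.
  rewrite mxE sum_enum_rank mulr_suml; apply: eq_bigr => x _.
  by rewrite !mxE !vw.
split=> [p v|p w]; last by rewrite (E _ (fun x => w (enum_rank x) 0)).
by rewrite -(E (\col_i v (enum_val i))) // => x; rewrite mxE enum_rankK.
Qed.

Lemma psd_mkop (R : realType) (T : finType) (K : T -> T -> R[i]) :
  psd (mkop K) <-> psd_kernel K.
Proof.
rewrite psdP; have -> // : coef (mkop K) = K.
by apply/funext => s; apply/funext => t; rewrite coef_mkop.
Qed.

(** The form of the pulled-back kernel at [v] is the form of [K] at the pushforward of [v] along
    [r]. *)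
Lemma psd_kernel_comp (R : realType) (X Y : finType) (r : X -> Y)
    (K : Y -> Y -> R[i]) :
  psd_kernel K -> psd_kernel (fun x y => K (r x) (r y)).
Proof.
move=> p v; have := p (fun s => \sum_(x | r x == s) v x).
congr (0 <= _); rewrite [RHS](partition_big r predT) //=.
apply: eq_bigr => s _; rewrite -[LHS]/(\sum_t _).
transitivity (\sum_(x | r x == s) \sum_t \sum_(y | r y == t)
    (v x)^* * K s t * v y).
  rewrite exchange_big /=; apply: eq_bigr => t _.
  rewrite rmorph_sum /= 2!mulr_suml; apply: eq_bigr => x _.
  by rewrite mulr_sumr.
apply: eq_bigr => x /eqP <-; rewrite [RHS](partition_big r predT) //=.
by apply: eq_bigr => t _; apply: eq_bigr => y /eqP <-.
Qed.

Lemma psd_kernel_sum (R : realType) (X I : finType) (P : pred I)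
    (K : I -> X -> X -> R[i]) :
  (forall i, P i -> psd_kernel (K i)) ->
  psd_kernel (fun x y => \sum_(i | P i) K i x y).
Proof.
move=> p v; rewrite [leRHS](_ : _ =
  \sum_(i | P i) \sum_x \sum_y (v x)^* * K i x y * v y).
  by apply: sumr_ge0 => i /p.
rewrite [RHS]exchange_big; apply: eq_bigr => x _ /=.
rewrite [RHS]exchange_big; apply: eq_bigr => y _ /=.
by rewrite mulr_sumr mulr_suml.
Qed.

Lemma psd_kernel_rank1 (R : realType) (X : finType) (b : X -> R[i]) :
  psd_kernel (fun x y => b x * (b y)^*).
Proof.
move=> v; rewrite [leRHS](_ : _ =
  (\sum_x b x * (v x)^*) * (\sum_x b x * (v x)^*)^*); first exact: mul_conjC_ge0.
rewrite rmorph_sum mulr_suml; apply: eq_bigr => x _.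
rewrite mulr_sumr; apply: eq_bigr => y _.
by rewrite rmorphM /= conjCK; ring.
Qed.

Lemma sum_two (V : nmodType) (X : finType) (x y : X) (F : X -> V) :
  x != y -> (forall z, z != x -> z != y -> F z = 0) -> \sum_z F z = F x + F y.
Proof.
move=> xy F0; rewrite (bigD1 x) //= (bigD1 y) 1?eq_sym //= big1 ?addr0 //.
by move=> z /andP[zx zy]; exact: F0.
Qed.

Lemma psd_kernel_diag (R : realType) (X : finType) (K : X -> X -> R[i]) x :
  psd_kernel K -> 0 <= K x x.
Proof.
move=> /(_ (fun z => (z == x)%:R)); congr (0 <= _).
rewrite (bigD1 x) //= [X in _ + X]big1 ?addr0; last first.
  move=> z /negPf ->; rewrite big1 // => y _; by rewrite conjC0 !mul0r.
rewrite (bigD1 x) //= big1 ?addr0 ?eqxx ?conjC1 ?mul1r ?mulr1 //.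
by move=> z /negPf ->; rewrite mulr0.
Qed.

Lemma psd_kernel2 (R : realType) (X : finType) (K : X -> X -> R[i]) x y a b :
  psd_kernel K -> x != y ->
  0 <= a^* * K x x * a + a^* * K x y * b + (b^* * K y x * a + b^* * K y y * b).
Proof.
move=> p xy; have := p (fun z => if z == x then a else if z == y then b else 0).
have yx : (y == x) = false by rewrite eq_sym (negPf xy).
congr (0 <= _); rewrite (sum_two xy) => [|z zx zy]; last first.
  by rewrite (negPf zx) (negPf zy) big1 // => u _; rewrite conjC0 !mul0r.
by rewrite !(sum_two xy) ?eqxx ?yx //
  => z zx zy; rewrite (negPf zx) (negPf zy) mulr0.
Qed.

(** Polarisation: the form is real at the vectors with entries 1, 1 and 1, ['i] at [x], [y], and
    these two conditions determine [K y x] from [K x y]. *)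
Lemma psd_kernel_herm (R : realType) (X : finType) (K : X -> X -> R[i]) x y :
  psd_kernel K -> K y x = (K x y)^*.
Proof.
move=> p; have [->|xy] := eqVneq x y.
  by rewrite geC0_conj // psd_kernel_diag.
have real a b : a^* * K x y * b + b^* * K y x * a \is Num.real.
  have /ger0_real := psd_kernel2 a b p xy.
  have Kx : a^* * K x x * a \is Num.real.
    by rewrite mulrAC [_ * a]mulrC realM ?ger0_real ?mul_conjC_ge0 ?psd_kernel_diag.
  have Ky : b^* * K y y * b \is Num.real.
    by rewrite mulrAC [_ * b]mulrC realM ?ger0_real ?mul_conjC_ge0 ?psd_kernel_diag.
  have -> : a^* * K x y * b + b^* * K y x * a =
    a^* * K x x * a + a^* * K x y * b + (b^* * K y x * a + b^* * K y y * b)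
     - a^* * K x x * a - b^* * K y y * b by ring.
  move=> H; by rewrite !rpredB.
have /CrealP := real 1 1; have /CrealP := real 1 'i.
rewrite !(rmorphD, rmorphM, conjCK, conjC1, conjCi) /= !(mul1r, mulr1).
rewrite !(rmorphN, conjC1, conjCi) /= !(conjCi, opprK, mul1r, mulr1) => e1 e2.
have {}e1 : (K x y)^* * 'i - (K y x)^* * 'i = K y x * 'i - K x y * 'i.
  apply/eqP; rewrite -subr_eq0 -oppr_eq0; apply/eqP.
  by move/eqP: e1; rewrite -subr_eq0 => /eqP e1; rewrite -[RHS]e1; ring.
have ni : 'i != 0 :> R[i] by exact: neq0Ci.
rewrite -!mulrBl in e1; move/(mulIf ni): e1 => e1.
have n2 : 2 != 0 :> R[i] by rewrite pnatr_eq0.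
apply: (mulIf n2).
transitivity ((K y x - K x y) + (K x y + K y x)); first by ring.
by rewrite -e1 -e2; ring.
Qed.

Local Open Scope sesquilinear_scope.

(** Spectral theorem: [b i] is the conjugate of the i-th row of the diagonalising unitary, scaled by
    the square root of the eigenvalue. *)
Lemma psd_kernel_decomp (R : realType) (X : finType) (K : X -> X -> R[i]) :
  psd_kernel K ->
  exists b : 'I_#|X| -> X -> R[i], forall x y, K x y = \sum_i b i x * (b i y)^*.
Proof.
move=> p; pose M : op R X := mkop K.
have Mp : psd M by apply/psd_mkop.
have Mh : M \is hermsymmx.
  rewrite is_hermitianmxE expr0 scale1r; apply/eqP/matrixP => i j.
  by rewrite !mxE; apply: psd_kernel_herm.
have /orthomx_spectralP Meq := hermitian_normalmx Mh.
set P := spectralmx M in Meq; set d := spectral_diag M in Meq.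
have Pu : P \is unitarymx by exact: spectral_unitarymx.
have /unitarymxP PPt := Pu.
rewrite invmx_unitary // in Meq.
(* The eigenvalue is the value of the form at the adjoint of the i-th row of [P]. *)
have d0 i : 0 <= d 0 i.
  have := Mp ((row i P) ^t*).
  have -> : (map_mx Num.conj ((row i P) ^t*))^T = row i P.
    by apply/matrixP => a b; rewrite !mxE conjCK.
  rewrite Meq !mulmxA -row_mul PPt -(mulmxA _ P).
  have -> : P *m (row i P) ^t* = (col i 1%:M).
    rewrite -PPt; apply/matrixP => a b; rewrite !mxE.
    by apply: eq_bigr => j _; rewrite !mxE.
  rewrite -row_mul mul1mx mxE (bigD1 i) //= big1 ?addr0 => [|j /negPf ji].
    by rewrite !mxE !eqxx !mulr1n mulr1.
  by rewrite !mxE eq_sym ji mulr0n mul0r.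
exists (fun i x => sqrtC (d 0 i) * (P i (enum_rank x))^*) => x y.
rewrite -[LHS](coef_mkop K) -/M /coef {1}Meq mxE.
apply: eq_bigr => i _; rewrite mul_mx_diag !mxE.
rewrite rmorphM /= conjCK (geC0_conj (x := sqrtC _)) ?sqrtC_ge0 //.
by rewrite -{1}[d 0 i]sqrtCK; ring.
Qed.

Local Close Scope sesquilinear_scope.

(** Schur product theorem. With [K] written as a sum of rank-one kernels, each rank-one factor is
    absorbed into the test vector for [L]. *)
Lemma psd_kernel_mul (R : realType) (X : finType) (K L : X -> X -> R[i]) :
  psd_kernel K -> psd_kernel L -> psd_kernel (fun x y => K x y * L x y).
Proof.
move=> /psd_kernel_decomp[b Kb] pL.
have -> : (fun x y => K x y * L x y) =
    fun x y => \sum_i (b i x * (b i y)^*) * L x y.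
  by apply/funext => x; apply/funext => y; rewrite Kb mulr_suml.
apply: psd_kernel_sum => i _ v; have := pL (fun x => (b i x)^* * v x).
congr (0 <= _); apply: eq_bigr => x _; apply: eq_bigr => y _.
by rewrite rmorphM /= conjCK; ring.
Qed.

Lemma psd_kernel_prod (R : realType) (X I : finType) (K : I -> X -> X -> R[i]) :
  (forall i, psd_kernel (K i)) -> psd_kernel (fun x y => \prod_i K i x y).
Proof.
move=> p; suff H s : psd_kernel (fun x y => \prod_(i <- s) K i x y) by exact: H.
elim: s => [|i s IHs].
  have -> : (fun x y : X => \prod_(i <- [::]) K i x y) =
      fun x y => (fun _ => 1) x * ((fun _ => 1) y)^*.
    by apply/funext => x; apply/funext => y; rewrite big_nil conjC1 mulr1.
  exact: psd_kernel_rank1.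
have -> : (fun x y : X => \prod_(j <- i :: s) K j x y) =
      fun x y => K i x y * \prod_(j <- s) K j x y.
  by apply/funext => x; apply/funext => y; rewrite big_cons.
exact: psd_kernel_mul.
Qed.

Lemma psd_kernel_eqop (R : realType) (X : finType) (Y : choiceType) (f : X -> Y) :
  psd_kernel (fun x y => (f x == f y)%:R : R[i]).
Proof.
(* [Y] may be infinite, so the sum over values runs over the image of [f]. *)
pose g x : seq_sub (codom f) := SeqSub (codom_f f x).
have -> : (fun x y => (f x == f y)%:R : R[i]) =
    fun x y => \sum_n (g x == n)%:R * ((g y == n)%:R)^*.
  apply/funext => x; apply/funext => y; rewrite (bigD1 (g x)) //= big1.
    by rewrite eqxx mul1r addr0 conjC_nat eq_sym.
  by move=> n /negPf nx; rewrite eq_sym nx mul0r.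
apply: psd_kernel_sum => n _; exact: psd_kernel_rank1.
Qed.

(** * Choi kernels and tensor products of completely positive maps *)

Lemma choi_psd (R : realType) (T S : finType) (E : op R T -> op R S) :
  completely_positive E ->
  psd_kernel (fun p q : T * S => coef (E (ketbra R p.1 q.1)) p.2 q.2).
Proof.
move=> cpE.
(* the unnormalised maximally entangled state *)
pose X : op R (T * T)%type :=
  mkop (fun p q => (p.1 == p.2)%:R * ((q.1 == q.2)%:R)^*).
have Xp : psd X by apply/psd_mkop/psd_kernel_rank1.
have /psdP := cpE _ _ Xp; congr psd_kernel.
apply/funext => -[u s]; apply/funext => -[v t]; rewrite coef_mkop /=.
congr (coef (E _) s t); apply: opP => x y.
by rewrite !coef_mkop coef_ketbra conjC_nat -natrM mulnb (eq_sym u) (eq_sym v).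
Qed.

Lemma coef_tensor_map (R : realType) (J X Z : finType) (T S : J -> finType)
    (r : forall j, X -> T j) (q : forall j, Z -> S j)
    (E : forall j, op R (T j) -> op R (S j)) (M : op R X) s t :
  coef (tensor_map r q E M) s t =
  \sum_x \sum_y coef M x y *
    \prod_j coef (E j (ketbra R (r j x) (r j y))) (q j s) (q j t).
Proof.
rewrite op_coef_sum; apply: eq_bigr => x _; rewrite op_coef_sum; apply: eq_bigr => y _.
by rewrite op_coefZ coef_mkop.
Qed.

(** The product of [coef M] with the Choi kernels of the [E j] is positive on [X * Z] by the Schur
    theorem; testing it on vectors constant along [X] gives the form of [tensor_map]. *)
Lemma tensor_map_psd (R : realType) (J X Z : finType) (T S : J -> finType)
    (r : forall j, X -> T j) (q : forall j, Z -> S j)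
    (E : forall j, op R (T j) -> op R (S j)) (M : op R X) :
  (forall j, completely_positive (E j)) -> psd M -> psd (tensor_map r q E M).
Proof.
move=> cpE /psdP Mp; apply/psdP => v.
pose K := fun a b : X * Z => coef M a.1 b.1 *
  \prod_j coef (E j (ketbra R (r j a.1) (r j b.1))) (q j a.2) (q j b.2).
have Kp : psd_kernel K.
  apply: psd_kernel_mul; first exact: (psd_kernel_comp fst).
  apply: psd_kernel_prod => j.
  exact: (psd_kernel_comp (fun a : X * Z => (r j a.1, q j a.2)) (choi_psd (cpE j))).
have := Kp (fun a => v a.2); congr (0 <= _).
rewrite -(pair_bigA _ (fun x s => \sum_y (v s)^* * K (x, s) y * v y.2)) /=.
rewrite exchange_big; apply: eq_bigr => s _ /=.
transitivity (\sum_x \sum_t \sum_y (v s)^* * K (x, s) (y, t) * v t).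
  apply: eq_bigr => x _.
  rewrite -(pair_bigA _ (fun y t => (v s)^* * K (x, s) (y, t) * v t)) /=.
  by rewrite exchange_big.
rewrite exchange_big; apply: eq_bigr => t _ /=.
rewrite coef_tensor_map mulr_sumr mulr_suml; apply: eq_bigr => x _.
by rewrite mulr_sumr mulr_suml.
Qed.

Lemma tensor_op_psd (R : realType) (J X : finType) (T : J -> finType)
    (r : forall j, X -> T j) (M : forall j, op R (T j)) :
  (forall j, psd (M j)) -> psd (tensor_op r M).
Proof.
move=> Mp; apply/psd_mkop/psd_kernel_prod => j.
by apply: psd_kernel_comp; apply/psdP.
Qed.

Lemma compatible_psd (R : realType) (G : network) (h : vis G -> finType)
    (rho : op R (tbasis h)) : compatible rho -> psd rho.
Proof.
move=> [k [rhoL [E [Ls Ec ->]]]]; apply: tensor_map_psd => [A|].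
  by case: (Ec A).
by apply: tensor_op_psd => L; case: (Ls L).
Qed.

(** * Networks with classical sources *)

Lemma prod_coef_forall (C : comPzSemiRingType) (I : finType) (P : pred I) (F : I -> C) :
  \prod_i ((P i)%:R * F i) = [forall i, P i]%:R * \prod_i F i.
Proof. by rewrite big_split /= prodr_forall. Qed.

(** A classical channel: [x] is read off in the basis and [s] is output with conditional probability
    [g x s]. *)
Definition response_map (R : realType) (X S : finType) (g : X -> S -> R[i])
    (M : op R X) : op R S :=
  mkop (fun s t => if s == t then \sum_x coef M x x * g x s else 0).

Lemma response_map_linear (R : realType) (X S : finType) (g : X -> S -> R[i]) :
  linear (response_map g).
Proof.
move=> a M N; apply: opP => s t; rewrite op_coefD op_coefZ !coef_mkop.
case: ifP => _; last by rewrite mulr0 addr0.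
rewrite mulr_sumr -big_split /=; apply: eq_bigr => x _.
by rewrite op_coefD op_coefZ mulrDl mulrA.
Qed.

HB.instance Definition _ (R : realType) (X S : finType) (g : X -> S -> R[i]) :=
  GRing.isLinear.Build R[i] (op R X) (op R S) _ (response_map g)
    (response_map_linear g).

Lemma coef_response_map (R : realType) (X S : finType) (g : X -> S -> R[i])
    u v s t :
  coef (response_map g (ketbra R u v)) s t =
  (s == t)%:R * ((u == v)%:R * g u s).
Proof.
rewrite coef_mkop; case: eqP => _; rewrite ?mul0r // mul1r.
rewrite (bigD1 u) //= big1 ?addr0 => [|x /negPf xu].
  by rewrite coef_ketbra eqxx.
by rewrite coef_ketbra xu mul0r.
Qed.

Lemma response_map_channel (R : realType) (X S : finType) (g : X -> S -> R[i]) :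
  (forall x s, 0 <= g x s) -> (forall x, \sum_s g x s = 1) ->
  is_channel (response_map g).
Proof.
move=> g0 g1; split=> [K M /psdP Mp|M]; last first.
  rewrite !mxtrace_coef; under eq_bigr => s _ do rewrite coef_mkop eqxx.
  rewrite exchange_big; apply: eq_bigr => x _ /=.
  by rewrite -mulr_sumr g1 mulr1.
apply/psd_mkop.
(* For each value read off, the kernel is a Schur product. Splitting [g] into two square roots gives
   a rank-one factor, and the indicator forces the two roots to agree. *)
have -> : (fun p q : K * S =>
    coef (response_map g (mkop (fun x y => coef M (p.1, x) (q.1, y)))) p.2 q.2) =
  fun p q => \sum_x (sqrtC (g x p.2) * (sqrtC (g x q.2))^*) *
     ((p.2 == q.2)%:R * coef M (p.1, x) (q.1, x)).
  apply/funext => -[a s]; apply/funext => -[b t]; rewrite coef_mkop /=.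
  case: eqP => [<-|_]; last by rewrite big1 // => x _; rewrite mul0r mulr0.
  apply: eq_bigr => x _; rewrite coef_mkop mul1r geC0_conj ?sqrtC_ge0 //.
  by rewrite -{1}[g x s]sqrtCK expr2 mulrC.
apply: psd_kernel_sum => x _; apply: psd_kernel_mul.
  exact: (psd_kernel_rank1 (fun p : K * S => sqrtC (g x p.2))).
apply: psd_kernel_mul; first exact: psd_kernel_eqop.
exact: (psd_kernel_comp (fun p : K * S => (p.1, x))).
Qed.

(** Each source [L] draws a letter with law [q L] and sends a copy of it along every outgoing edge;
    each [A] then responds by [r A]. All edges carry the same alphabet [T]. *)
Lemma classical_compatible (R : realType) (G : network) (h : vis G -> finType)
    (T : finType) (t0 : T) (q : lat G -> T -> R[i])
    (r : forall A, (lat G -> T) -> h A -> R[i]) :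
  (forall L t, 0 <= q L t) -> (forall L, \sum_t q L t = 1) ->
  (forall A l s, 0 <= r A l s) -> (forall A l, \sum_s r A l s = 1) ->
  (forall A l l', (forall L, edge L A -> l L = l' L) -> r A l =1 r A l') ->
  compatible (diagonal_state (fun s : tbasis h =>
    \sum_(l : {ffun lat G -> T}) \prod_L q L (l L) * \prod_A r A l (s A))).
Proof.
move=> q0 q1 r0 r1 rdep.
pose k := fun _ : edges G => T.
pose cst L t : tbasis (fun A => k (@edge_to_child G L A)) := finfun (fun=> t).
pose rhoL L : op R (tbasis (fun A => k (@edge_to_child G L A))) :=
  mkop (fun x y => \sum_t q L t * ((x == cst L t)%:R * (y == cst L t)%:R)).
(* Letters of latents that are not parents of [A] get the default [t0]; by [rdep] the response does
   not depend on this choice. *)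
pose glob A (x : tbasis (fun L => k (@edge_from_parent G A L))) : lat G -> T :=
  fun L => if insub L is Some l then x l else t0.
pose E A : {linear op R (tbasis (fun L => k (@edge_from_parent G A L))) ->
      op R (h A)} := response_map (fun x s => r A (glob A x) s).
exists k, rhoL, E; split=> [L|A|].
- split.
    apply/psd_mkop.
    have -> : (fun x y : tbasis (fun A => k (@edge_to_child G L A)) =>
         \sum_t q L t * ((x == cst L t)%:R * (y == cst L t)%:R)) =
      fun x y => \sum_t (sqrtC (q L t) * (x == cst L t)%:R) *
                        (sqrtC (q L t) * (y == cst L t)%:R)^*.
      apply/funext => x; apply/funext => y; apply: eq_bigr => t _.
      rewrite rmorphM /= conjC_nat geC0_conj ?sqrtC_ge0 //.
      by rewrite -{1}[q L t]sqrtCK; ring.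
    apply: psd_kernel_sum => t _.
    exact: (psd_kernel_rank1 (fun x => sqrtC (q L t) * (x == cst L t)%:R)).
  rewrite mxtrace_coef; under eq_bigr => x _ do rewrite coef_mkop.
  rewrite exchange_big -[RHS](q1 L); apply: eq_bigr => t _ /=.
  rewrite -mulr_sumr (bigD1 (cst L t)) //= eqxx big1 ?addr0 ?mulr1 //.
  by move=> x /negPf ->; rewrite mulr0.
- by apply: response_map_channel => *; rewrite ?r1.
apply: opP => s t; rewrite coef_tensor_map coef_mkop.
(* [spread l] is the only labelling of the edges consistent with the letters [l], so the sums over
   edge labels collapse. *)
pose spread (l : {ffun lat G -> T}) : tbasis k := finfun (fun e => l (val e).1).
have spreadE x (l : {ffun lat G -> T}) :
    [forall L, reindex_tb (@edge_to_child G L) x == cst L (l L)] = (x == spread l).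
  rewrite dffun_eqE; apply/forallP/forallP => [H e|H L].
    case eE: e => [[L A] LA]; rewrite -eE.
    have -> : e = edge_to_child (exist (fun A => edge L A) A LA).
      by rewrite eE; exact: val_inj.
    by rewrite -reindex_tbE (eqP (H L)) !ffunE.
  apply/eqP/tbasisP => A; rewrite reindex_tbE ffunE.
  by rewrite (eqP (H (edge_to_child A))) ffunE.
have globE (l : {ffun lat G -> T}) A L : edge L A ->
    glob A (reindex_tb (@edge_from_parent G A) (spread l)) L = l L.
  by move=> LA; rewrite /glob insubT reindex_tbE ffunE.
transitivity (\sum_(l : {ffun lat G -> T}) \prod_L q L (l L) *
    ((s == t)%:R * \prod_A r A l (s A))).
  case: eqP => [_|_]; last by rewrite big1 // => l _; rewrite mul0r mulr0.
  by apply: eq_bigr => l _; rewrite mul1r.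
symmetry.
transitivity (\sum_(l : {ffun lat G -> T}) \sum_(x : tbasis k) \sum_(y : tbasis k)
   (x == spread l)%:R * ((y == spread l)%:R * (\prod_L q L (l L) *
   \prod_A coef (E A (ketbra R (reindex_tb (@edge_from_parent G A) x)
     (reindex_tb (@edge_from_parent G A) y))) (s A) (t A)))).
  rewrite [RHS]exchange_big; apply: eq_bigr => x _ /=.
  rewrite [RHS]exchange_big; apply: eq_bigr => y _ /=.
  rewrite coef_mkop; under eq_bigr => L _ do rewrite coef_mkop.
  rewrite bigA_distr_bigA mulr_suml; apply: eq_bigr => l _ /=.
  rewrite big_split /= big_split /= !prodr_forall !spreadE; ring.
apply: eq_bigr => l _.
rewrite (bigD1 (spread l)) //= [X in _ + X]big1 ?addr0; last first.
  by move=> x /negPf ->; rewrite big1 // => y _; rewrite mul0r.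
rewrite (bigD1 (spread l)) //= [X in _ + X]big1 ?addr0; last first.
  by move=> x /negPf ->; rewrite mul0r mulr0.
rewrite eqxx !mul1r; congr (_ * _).
under eq_bigr => A _ do rewrite coef_response_map.
rewrite prod_coef_forall -dffun_eqE; congr (_ * _); apply: eq_bigr => A _.
by rewrite eqxx mul1r; apply: rdep => L; exact: globE.
Qed.

(** * The triangle and its cut inflation *)

(** Arrows go only from latent to visible nodes, so no path has more than one arrow. *)
Lemma connect_arc (G : network) (x y : node G) :
  connect (@arc G) x y = (x == y) || arc x y.
Proof.
apply/connectP/orP => [[[|u [|w p]] /=]|[/eqP <-|xy]].
- by move=> _ ->; left.
- by rewrite andbT => xu ->; right.
- by case: x => // L; case: u => // A /andP[_]; case: w.
- by exists [::].
by exists [:: y]; rewrite //= xy.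
Qed.

Lemma ancestral_latent (G : network) (L : lat G) :
  ancestral [set inl L : node G] = [set inl L].
Proof.
apply/setP => x; rewrite !inE; apply/existsP/eqP => [[u]|->].
  by rewrite inE => /andP[/eqP ->]; rewrite connect_arc; case: x => [L'|A] /orP[/eqP ->|].
by exists (inl L); rewrite inE connect0 eqxx.
Qed.

Lemma in_ancestral_latent (G : network) (U : {set vis G}) (L : lat G) :
  ((inl L : node G) \in ancestral (vis_nodes U)) = [exists A in U, edge L A].
Proof.
rewrite inE; apply/existsP/existsP => [[u /andP[/imsetP[A AU ->]]]|[A /andP[AU LA]]].
  by rewrite connect_arc /= => LA; exists A; rewrite AU.
by exists (inr A); rewrite connect_arc /= LA andbT; apply/imsetP; exists A.
Qed.

Lemma in_ancestral_visible (G : network) (U : {set vis G}) (A : vis G) :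
  ((inr A : node G) \in ancestral (vis_nodes U)) = (A \in U).
Proof.
rewrite inE; apply/existsP/idP => [[u /andP[/imsetP[B BU ->]]]|AU].
  by rewrite connect_arc /= orbF => /eqP[->].
by exists (inr A); rewrite connect0 andbT; apply/imsetP; exists A.
Qed.

Lemma vis_nodes1 (G : network) (A : vis G) :
  vis_nodes [set A] = [set inr A : node G].
Proof. exact: imset_set1. Qed.

Definition vA : 'I_3 := @Ordinal 3 0 isT.
Definition vB : 'I_3 := @Ordinal 3 1 isT.
Definition vC : 'I_3 := @Ordinal 3 2 isT.

(* A latent of the triangle is named after the visible node it does not feed. *)
Definition triangle : network := @Network 'I_3 'I_3 (fun L A => L != A).

(* The source of the edges to vA and vC, that is the latent vB, is split into
   the latents 1 and 3. *)
Definition cut_edge (L : 'I_4) (A : 'I_3) : bool :=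
  match val L with
  | 0 => A != vA
  | 1 => A == vA
  | 2 => A != vC
  | _ => A == vC
  end.

Definition cut : network := @Network 'I_4 'I_3 cut_edge.

Definition cut_drop (L : 'I_4) : 'I_3 :=
  match val L with 0 => vA | 2 => vC | _ => vB end.

Definition cut_proj : node cut -> node triangle :=
  @drop_node cut triangle cut_drop id.

Lemma I3P (P : 'I_3 -> Prop) : P vA -> P vB -> P vC -> forall i, P i.
Proof.
move=> PA PB PC [[|[|[|//]]] i];
  [move: PA|move: PB|move: PC]; congr P; exact: val_inj.
Qed.

Lemma big_I3 (R : Type) (idx : R) (op : Monoid.law idx) (F : 'I_3 -> R) :
  \big[op/idx]_i F i = op (F vA) (op (F vB) (F vC)).
Proof.
rewrite !big_ord_recl big_ord0 Monoid.mulm1.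
by congr (op _ (op _ _)); congr F; exact: val_inj.
Qed.

Lemma cut_edge_proj L A : cut_edge L A -> cut_drop L != A.
Proof. by case: L => [[|[|[|[|//]]]] iL]; move: A; apply: I3P. Qed.

Lemma cut_edge_lift (L A : 'I_3) : L != A ->
  exists2 L', cut_edge L' A & cut_drop L' = L.
Proof.
move: L A; apply: I3P; apply: I3P => // _;
  by [exists (@Ordinal 4 0 isT)|exists (@Ordinal 4 1 isT)|
      exists (@Ordinal 4 2 isT)|exists (@Ordinal 4 3 isT)].
Qed.

(** At most one of the copies 1 and 3 of the latent [vB] is an ancestor of such a [U], so the cut is
    not seen from [U]. *)
Lemma cut_iso (U : {set 'I_3}) : ~~ ((vA \in U) && (vC \in U)) ->
  @ancestral_iso cut triangle cut_proj (@vis_nodes cut U).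
Proof.
move=> UAC.
have projU : cut_proj @: (@vis_nodes cut U) = @vis_nodes triangle U.
  by rewrite /vis_nodes -imset_comp.
(* An arrow of the triangle could fail to lift only for a copy of [vB] aimed at the wrong one of
   [vA] and [vC], and then both would lie in [U]. *)
have aU A : U = U -> forall L, (inl L : node cut) \in ancestral (@vis_nodes cut U) ->
    A \in U -> cut_drop L != A -> cut_edge L A.
  move=> _ [[|[|[|[|//]]]] iL]; rewrite in_ancestral_latent
    => /existsP[A' /andP[/= AU' LA']] AU; move: LA' AU' AU UAC => /=;
  move: A' A; apply: I3P; apply: I3P => //= _ AU' AU;
  by rewrite ?AU' ?AU.
split.
- move=> [L|A] [L'|A'] // xU yU; last by move=> [->].
  move=> [e]; congr inl; move: xU yU UAC e; rewrite !in_ancestral_latent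
    => /existsP[A' /andP[/= AU' LA']] /existsP[A /andP[/= AU LA]].
  case: L LA' => [[|[|[|[|//]]]] iL] + ; case: L' LA => [[|[|[|[|//]]]] iL'];
    move: A A' AU AU'; apply: I3P; apply: I3P => //= AU AU' _ _;
    rewrite ?AU ?AU' // => _ _; exact: val_inj.
- apply/setP => -[L|A]; rewrite projU ?in_ancestral_latent ?in_ancestral_visible.
    apply/imsetP/existsP => [[[L'|//] L'U [->]]|[A /andP[AU LA]]].
      move: L'U; rewrite in_ancestral_latent => /existsP[A /andP[AU LA]].
      by exists A; rewrite AU; exact: cut_edge_proj.
    have [L' LA' <-] := cut_edge_lift LA.
    exists (inl L') => //; rewrite in_ancestral_latent.
    by apply/existsP; exists A; rewrite AU.
  apply/imsetP/idP => [[[//|A'] + [->]]|AU]; first by rewrite in_ancestral_visible.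
  by exists (inr A); rewrite ?in_ancestral_visible.
move=> [L|A] [L'|A'] // LU; rewrite in_ancestral_visible => AU.
by apply/idP/idP; [exact: cut_edge_proj|exact: aU].
Qed.

Lemma cut_drop_surj (x : node triangle) : exists x' : node cut, cut_proj x' = x.
Proof.
case: x => [L|A]; last by exists (inr A).
by move: L; apply: I3P; [exists (inl (@Ordinal 4 0 isT))|
  exists (inl (@Ordinal 4 1 isT))|exists (inl (@Ordinal 4 2 isT))].
Qed.

Lemma cut_drop_ancestral (x' : node cut) :
  @ancestral_iso cut triangle cut_proj [set x'].
Proof.
case: x' => [L|A].
  split; rewrite ?imset_set1 ?ancestral_latent ?imset_set1 //.
    by move=> x y /set1P -> /set1P ->.
  by move=> x y /set1P -> /set1P ->.
rewrite -(@vis_nodes1 cut); apply: cut_iso; rewrite !inE.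
by move: A; apply: I3P.
Qed.

Definition cut_inflation : inflation triangle :=
  @Inflation triangle cut cut_drop id cut_drop_surj cut_drop_ancestral.

(** If [U] contained both [vA] and [vC], the latents 1 and 3 would be distinct ancestors with the
    same image. *)
Lemma cut_injectable (U : {set 'I_3}) :
  @injectable triangle cut_inflation U <-> ~~ ((vA \in U) && (vC \in U)).
Proof.
split=> [[_ [inj _ _]]|UAC]; last by split; [move=> ? ? _ _|exact: cut_iso].
apply/negP => /andP[AU CU].
have : (inl (@Ordinal 4 1 isT) : node cut) = inl (@Ordinal 4 3 isT).
  apply: inj => //; rewrite in_ancestral_latent; apply/existsP.
    by exists vA; rewrite AU.
  by exists vC; rewrite CU.
by [].
Qed.

(** [vB] shares latent 2 with [vA] and latent 0 with [vC], which leaves no room for another nonempty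
    part. *)
Lemma cut_part_B (Y : expressible cut_inflation) j k :
  vB \in part Y j -> k != j -> part Y k = set0.
Proof.
move=> Bj kj; apply/setP => A; rewrite inE; apply/negP => Ak.
have D := part_disjoint kj.
have no_common x : x \in ancestral (vis_nodes (part Y k)) ->
    x \in ancestral (vis_nodes (part Y j)) -> False.
  by move=> xk; rewrite (disjointFr D xk).
have no_latent L : cut_edge L A -> cut_edge L vB -> False.
  move=> LA LB; apply: (no_common (inl L)); rewrite in_ancestral_latent;
    apply/existsP; [exists A|exists vB]; exact/andP.
move: A Ak no_latent; apply: I3P => Ak no_latent.
- exact: (no_latent (@Ordinal 4 2 isT)).
- by apply: (no_common (inr vB)); rewrite in_ancestral_visible.
- exact: (no_latent (@Ordinal 4 0 isT)).
Qed.

Lemma part_disjoint_vis (G : network) (G' : inflation G) (Y : expressible G') j k A :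
  A \in part Y j -> A \in part Y k -> j = k.
Proof.
move=> Aj Ak; apply/eqP; apply/negPn/negP => jk.
have := disjointFr (part_disjoint jk) (x := inr A).
by rewrite !in_ancestral_visible Aj Ak => /(_ isT).
Qed.

Definition injectable_expressible (G : network) (G' : inflation G)
    (U : {set vis G'}) (injU : injectable U) : expressible G'.
Proof.
refine (@Expressible G G' 1 (fun=> U) (fun=> injU) _).
by move=> j k; rewrite !ord1.
Defined.

Lemma expr_set_injectable (G : network) (G' : inflation G) (U : {set vis G'})
    (injU : injectable U) : expr_set (injectable_expressible injU) = U.
Proof. by rewrite /expr_set big_ord1. Qed.

Definition cut_AC_part (j : 'I_2) : {set vis cut_inflation} :=
  if j == ord0 then [set vA] else [set vC].

Lemma cut_AC_injectable j : injectable (cut_AC_part j).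
Proof. by apply/cut_injectable; rewrite /cut_AC_part; case: ifP; rewrite !inE. Qed.

Lemma cut_AC_disjoint j k : j != k ->
  [disjoint ancestral (vis_nodes (cut_AC_part j)) &
            ancestral (vis_nodes (cut_AC_part k))].
Proof.
have D : [disjoint ancestral (@vis_nodes cut_inflation [set vA]) &
                   ancestral (@vis_nodes cut_inflation [set vC])].
  rewrite -setI_eq0; apply/eqP/setP => -[L|A]; rewrite in_set0 inE;
    rewrite ?in_ancestral_latent ?in_ancestral_visible; apply/negP => /andP[].
    move=> /existsP[A /andP[/set1P -> LA]] /existsP[C /andP[/set1P -> LC]].
    by case: L LA LC => [[|[|[|[|//]]]] iL].
  by rewrite !inE => /eqP ->.
rewrite /cut_AC_part; case: j => [[|[|//]] ij]; case: k => [[|[|//]] ik] //= _.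
by rewrite disjoint_sym.
Qed.

Definition cut_AC : expressible cut_inflation :=
  Expressible cut_AC_injectable cut_AC_disjoint.

Lemma expr_set_cut_AC : expr_set cut_AC = [set vA; vC].
Proof. by rewrite /expr_set big_ord_recl big_ord1. Qed.

(** * Expansions in product operators *)

(** The qubit operators and their tables of measurement outcomes have this form with the same lists
    [ts] and different local factors [q], so that marginals and [sigma] are computed once for
    both. *)
Definition expansion (R : realType) (h : 'I_3 -> finType)
    (q : forall i, option bool -> h i -> h i -> R[i])
    (ts : seq (seq (option bool))) : op R (tbasis h) :=
  mkop (fun x y : tbasis h => \sum_(t <- ts) \prod_i q i (nth None t i) (x i) (y i)).

Definition expansion_on (R : realType) (h : 'I_3 -> finType)
    (q : forall i, option bool -> h i -> h i -> R[i])
    (ts : seq (seq (option bool))) (U : {set 'I_3}) (x y : tbasis h) : R[i] :=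
  \sum_(t <- ts) \prod_i
    if i \in U then q i (nth None t i) (x i) (y i) else (nth None t i == None)%:R.

(** Tracing out a site keeps exactly the terms with [None] there, as all other local factors are
    traceless. *)
Lemma coef_marginal_expansion (R : realType) (h : 'I_3 -> finType)
    (q : forall i, option bool -> h i -> h i -> R[i]) 
    (J : finType) (f : J -> 'I_3) ts (x y : tbasis h) :
  (forall i t, \sum_k q i t k k = (t == None)%:R) ->
  coef (marginal f (expansion q ts)) (reindex_tb f x) (reindex_tb f y) =
  expansion_on q ts [set i in codom f] x y.
Proof.
move=> q_trace; rewrite coef_marginal; under eq_bigr => z _ do rewrite coef_mkop.
rewrite exchange_big; apply: eq_bigr => t _ /=.
rewrite [RHS](eq_bigr (fun i => if i \in codom f then q i (nth None t i) (x i) (y i)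
  else \sum_k q i (nth None t i) k k)).
  rewrite -(coef_marginal_prod f (fun i => q i (nth None t i))) coef_marginal.
  by apply: eq_bigr => z _; rewrite coef_mkop.
by move=> i _; rewrite inE; case: ifP => // _; rewrite q_trace.
Qed.

(* Indices of product terms: Some true and Some false stand for the raising and
   lowering operators, None for the normalised identity. *)
Definition cut_terms : seq (seq (option bool)) :=
  let n := None in let p := Some true in let m := Some false in
  [:: [:: n; n; n]; [:: p; m; n]; [:: m; p; n]; [:: n; p; m]; [:: n; m; p]].

Definition triangle_terms : seq (seq (option bool)) :=
  let n := None in let p := Some true in let m := Some false in
  cut_terms ++ [:: [:: p; n; m]; [:: m; n; p]].

(** The two additional terms are nontrivial at both [vA] and [vC], hence vanish when one of these is
    traced out. *)
Lemma expansion_on_cut (R : realType) (h : 'I_3 -> finType)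
    (q : forall i, option bool -> h i -> h i -> R[i]) (U : {set 'I_3}) x y :
  ~~ ((vA \in U) && (vC \in U)) ->
  expansion_on q triangle_terms U x y = expansion_on q cut_terms U x y.
Proof.
move=> UAC; rewrite /expansion_on /triangle_terms big_cat /= -[RHS]addr0.
congr (_ + _); rewrite !big_cons big_nil !big_I3 /= addr0.
by case: ifP UAC => _ /=; [move=> /negPf ->|]; rewrite ?mul0r ?mulr0 ?addr0.
Qed.

(** Every term of [cut_terms] other than the first is nontrivial at [vB]. *)
Lemma expansion_on_cut_product (R : realType) (h : 'I_3 -> finType)
    (q : forall i, option bool -> h i -> h i -> R[i]) (U : {set 'I_3}) x y :
  vB \notin U ->
  expansion_on q cut_terms U x y =
  \prod_i if i \in U then q i None (x i) (y i) else 1.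
Proof.
move=> /negPf BU; rewrite /expansion_on !big_cons big_nil !big_I3 /= BU.
by rewrite !(mul0r, mulr0, addr0).
Qed.

(** If some part contains [vB], it is the whole of [expr_set Y], and it misses [vA] or [vC], so
    [triangle_terms] and [cut_terms] agree on it. Otherwise both sides are products over single
    sites. *)
Lemma sigma_expansion (R : realType) (h : 'I_3 -> finType) (d : tbasis h)
    (q : forall i, option bool -> h i -> h i -> R[i])
    (Y : expressible cut_inflation) :
  (forall i t, \sum_k q i t k k = (t == None)%:R) ->
  sigma (expansion q triangle_terms : op R (@tbasis (vis triangle) h)) Y =
  marginal (fun a : {a : vis cut_inflation | a \in expr_set Y} => val a)
    (expansion q cut_terms).
Proof.
move=> q_trace; apply: opP => s t.
rewrite -(extendK d val_inj s) -(extendK d val_inj t).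
set x := extend d s; set y := extend d t.
rewrite (coef_marginal_expansion _ _ _ _ q_trace) coef_mkop.
have -> : [set i in codom (fun a : {a : vis cut_inflation | a \in expr_set Y} => val a)]
    = expr_set Y.
  apply/setP => i; rewrite inE; apply/codomP/idP => [[a ->]|iY]; first exact: (valP a).
  by exists (exist _ i iY).
transitivity (\prod_j expansion_on q triangle_terms (part Y j) x y).
  apply: eq_bigr => j _.
  have e (z : tbasis h) : reindex_tb (@part_incl triangle cut_inflation Y j)
      (reindex_tb (fun a : {a : vis cut_inflation | a \in expr_set Y} => val a) z)
    = reindex_tb (fun a : {a : vis cut_inflation | a \in part Y j} => val a) z.
    by apply: tbasisP => a; rewrite !ffunE.
  rewrite !e (coef_marginal_expansion _ _ _ _ q_trace); congr (expansion_on _ _ _ _ _).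
  apply/setP => i; rewrite inE; apply/codomP/idP => [[a ->]|iY]; first exact: (valP a).
  by exists (exist _ i iY).
have inj j := iffLR (cut_injectable _) (@part_injectable _ _ Y j).
under eq_bigr => j _ do rewrite expansion_on_cut ?inj //.
have [/existsP[j0 Bj0]|/existsPn nB] := boolP [exists j, vB \in part Y j].
  have others k : k != j0 -> part Y k = set0 by exact: cut_part_B.
  have -> : expr_set Y = part Y j0.
    rewrite /expr_set (bigD1 j0) //= big1 ?setU0 // => k; exact: others.
  rewrite (bigD1 j0) //= big1 ?mulr1 // => k /others ->.
  rewrite expansion_on_cut_product ?inE // big1 // => i _; by rewrite inE.
under eq_bigr => j _ do rewrite expansion_on_cut_product ?nB //.
rewrite expansion_on_cut_product; last first.
  by apply/bigcupP => -[j _ Bj]; move: (nB j); rewrite Bj.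
rewrite exchange_big; apply: eq_bigr => i _ /=.
case: ifPn => [/bigcupP[j _ ij]|iY].
  rewrite (bigD1 j) //= ij big1 ?mulr1 // => k kj.
  case: ifP => // ik.
  by rewrite (@part_disjoint_vis triangle cut_inflation Y k j i) ?eqxx in kj.
rewrite big1 // => j _; case: ifP => // ij.
by case/bigcupP: iY; exists j.
Qed.

(** * Three qubits *)

Definition qubits : 'I_3 -> finType := fun=> bool.

Definition qubit_op (R : realType) (t : option bool) (a b : bool) : R[i] :=
  match t with
  | None => (a == b)%:R / 2
  | Some true => (a && ~~ b)%:R / 2
  | Some false => (~~ a && b)%:R / 2
  end.

Definition qubit_ops (R : realType) (i : 'I_3) (t : option bool)
    (a b : qubits i) : R[i] := qubit_op R t a b.

Lemma half_add (R : realType) : 2^-1 + 2^-1 = 1 :> R[i].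
Proof. by rewrite -mulr2n -(mulr_natl 2^-1) divff ?pnatr_eq0. Qed.

Lemma qubit_ops_trace (R : realType) i t :
  \sum_k @qubit_ops R i t k k = (t == None)%:R.
Proof.
rewrite big_bool /qubit_ops; case: t => [[]|] /=; rewrite ?mul0r ?addr0 //.
by rewrite mul1r half_add.
Qed.

Definition bits (a b c : bool) : tbasis qubits :=
  finfun (fun i : 'I_3 => match val i with 0 => a | 1 => b | _ => c end).

Lemma bitsA a b c : bits a b c vA = a. Proof. by rewrite ffunE. Qed.
Lemma bitsB a b c : bits a b c vB = b. Proof. by rewrite ffunE. Qed.
Lemma bitsC a b c : bits a b c vC = c. Proof. by rewrite ffunE. Qed.
Definition bitsE := (bitsA, bitsB, bitsC).

Lemma bits_eta (x : tbasis qubits) : bits (x vA) (x vB) (x vC) = x.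
Proof. by apply: tbasisP; apply: I3P; rewrite ?bitsE. Qed.

Lemma sum_bits (V : nmodType) (F : tbasis qubits -> V) :
  \sum_x F x = \sum_a \sum_b \sum_c F (bits a b c).
Proof.
rewrite pair_bigA pair_bigA /=.
rewrite (reindex (fun p : bool * bool * bool => bits p.1.1 p.1.2 p.2)) //.
exists (fun x : tbasis qubits => (x vA, x vB, x vC)) => [[[a b] c] _|x _] /=.
  by rewrite !bitsE.
exact: bits_eta.
Qed.

Lemma forall_I3 (P : pred 'I_3) : [forall i, P i] = [&& P vA, P vB & P vC].
Proof.
apply/forallP/and3P => [H|[HA HB HC]]; first by split.
by apply: I3P.
Qed.

(** A marginal with rows and columns still labelled by the whole product basis, which avoids a
    different label type for each [U]. *)
Definition partial_trace (R : realType) (I : finType) (h : I -> finType)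
    (tau : tbasis h -> tbasis h -> R[i]) (U : {set I}) (x y : tbasis h) : R[i] :=
  \sum_(z : tbasis h | [forall i, (i \in U) ==> (z i == x i)]) tau z (mix U y z).

Lemma mix_bits U a b c a' b' c' : mix U (bits a b c) (bits a' b' c') =
  bits (if vA \in U then a else a') (if vB \in U then b else b')
       (if vC \in U then c else c').
Proof. by apply: tbasisP; apply: I3P; rewrite mixE !bitsE. Qed.

(** * Operators with the marginals of the cut expansion are not positive *)

Section Witness.
Variables (R : realType) (tau : tbasis qubits -> tbasis qubits -> R[i]).

Lemma partial_trace_AB a b a' b' c c' :
  partial_trace tau [set vA; vB] (bits a b c) (bits a' b' c') =
  tau (bits a b false) (bits a' b' false) + tau (bits a b true) (bits a' b' true).
Proof.
rewrite /partial_trace big_mkcond sum_bits !big_bool /=.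
rewrite !forall_I3 !inE /= !bitsE !mix_bits !inE /=.
by case: a; case: b; rewrite /= ?addr0 ?add0r addrC.
Qed.

Lemma partial_trace_BC a b a' b' c c' :
  partial_trace tau [set vB; vC] (bits c a b) (bits c' a' b') =
  tau (bits false a b) (bits false a' b') + tau (bits true a b) (bits true a' b').
Proof.
rewrite /partial_trace big_mkcond sum_bits !big_bool /=.
rewrite !forall_I3 !inE /= !bitsE !mix_bits !inE /=.
by case: a; case: b; rewrite /= ?addr0 ?add0r addrC.
Qed.

Lemma partial_trace_AC a b a' b' c c' :
  partial_trace tau [set vA; vC] (bits a c b) (bits a' c' b') =
  tau (bits a false b) (bits a' false b') + tau (bits a true b) (bits a' true b').
Proof.
rewrite /partial_trace big_mkcond sum_bits !big_bool /=.
rewrite !forall_I3 !inE /= !bitsE !mix_bits !inE /=.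
by case: a; case: b; rewrite /= ?addr0 ?add0r addrC.
Qed.

Lemma cut_marginals_not_psd :
  (forall U x y, U \in [:: [set vA; vB]; [set vB; vC]; [set vA; vC]] ->
    partial_trace tau U x y = expansion_on (@qubit_ops R) cut_terms U x y) ->
  ~ psd_kernel tau.
Proof.
move=> marg p.
pose f := false; pose t := true.
have mAB : [set vA; vB] \in [:: [set vA; vB]; [set vB; vC]; [set vA; vC]].
  by rewrite inE eqxx.
have mBC : [set vB; vC] \in [:: [set vA; vB]; [set vB; vC]; [set vA; vC]].
  by rewrite !inE eqxx orbT.
have mAC : [set vA; vC] \in [:: [set vA; vB]; [set vB; vC]; [set vA; vC]].
  by rewrite !inE eqxx !orbT.
have AB a b a' b' := etrans (esym (partial_trace_AB a b a' b' f f)) (marg _ _ _ mAB).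
have BC a b a' b' := etrans (esym (partial_trace_BC a b a' b' f f)) (marg _ _ _ mBC).
have AC a b a' b' := etrans (esym (partial_trace_AC a b a' b' f f)) (marg _ _ _ mAC).
pose W (U : {set 'I_3}) (x y : tbasis qubits) i o :=
  if i \in U then @qubit_ops R i o (x i) (y i) else (o == None)%:R.
have exp (U : {set 'I_3}) x y : expansion_on (@qubit_ops R) cut_terms U x y =
    let w := W U x y in let n := None in let u := Some true in let d := Some false in
    w vA n * (w vB n * w vC n) + (w vA u * (w vB d * w vC n) +
    (w vA d * (w vB u * w vC n) + (w vA n * (w vB u * w vC d) +
    w vA n * (w vB d * w vC u)))).
  by rewrite /expansion_on !big_cons big_nil !big_I3 addr0.
(* [r f i] is the string with a single one at [i], and [r t i] its bit flip; the sign at [vB] makes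
   the AB and BC coherences count negatively. *)
pose v (i : 'I_3) : R[i] := if i == vB then -1 else 1.
pose r (s : bool) (i : 'I_3) :=
  bits (s (+) (i == vA)) (s (+) (i == vB)) (s (+) (i == vC)).
have := addr_ge0 (psd_kernel_comp (r f) p v) (psd_kernel_comp (r t) p v).
rewrite !big_I3 /v /r /= !(rmorphN, conjC1) /= !conjC1.
set Q := (X in 0 <= X); suff -> : Q = - 4^-1.
  by rewrite oppr_ge0 invr_le0 lt_geF ?ltr0n.
have trE : 1 = tau (bits f f f) (bits f f f) + tau (bits f f t) (bits f f t) +
  (tau (bits f t f) (bits f t f) + tau (bits f t t) (bits f t t)) +
  (tau (bits t f f) (bits t f f) + tau (bits t f t) (bits t f t)) +
  (tau (bits t t f) (bits t t f) + tau (bits t t t) (bits t t t)).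
  rewrite !AB !exp /W !inE /= !bitsE /qubit_ops /=.
  by field.
(* Two-body form of [Q]. A nonconstant string has exactly one pair of equal bits and a constant one
   has three, so 3/2 of the trace minus half the probabilities of equal pairs is the weight of the
   nonconstant strings. Each off-diagonal entry is paired with the one whose spectator bit is
   flipped. The value is 3/2 - 3/4 - 4/4. *)
transitivity (
  (tau (bits f f f) (bits f f f) + tau (bits f f t) (bits f f t) +
  (tau (bits f t f) (bits f t f) + tau (bits f t t) (bits f t t)) +
  (tau (bits t f f) (bits t f f) + tau (bits t f t) (bits t f t)) +
  (tau (bits t t f) (bits t t f) + tau (bits t t t) (bits t t t))) * (3 / 2)
  - 2^-1 * ((tau (bits f f f) (bits f f f) + tau (bits f f t) (bits f f t)) +
            (tau (bits t t f) (bits t t f) + tau (bits t t t) (bits t t t)) +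
            (tau (bits f f f) (bits f f f) + tau (bits t f f) (bits t f f)) +
            (tau (bits f t t) (bits f t t) + tau (bits t t t) (bits t t t)) +
            (tau (bits f f f) (bits f f f) + tau (bits f t f) (bits f t f)) +
            (tau (bits t f t) (bits t f t) + tau (bits t t t) (bits t t t)))
  - (tau (bits t f f) (bits f t f) + tau (bits t f t) (bits f t t))
  - (tau (bits f t f) (bits t f f) + tau (bits f t t) (bits t f t))
  - (tau (bits f t f) (bits f f t) + tau (bits t t f) (bits t f t))
  - (tau (bits f f t) (bits f t f) + tau (bits t f t) (bits t t f))
  + (tau (bits t f f) (bits f f t) + tau (bits t t f) (bits f t t))
  + (tau (bits f f t) (bits t f f) + tau (bits f t t) (bits t t f))).
  by rewrite /Q /f /t /=; field.
rewrite -trE !AB !BC !AC !exp /W !inE /= !bitsE /qubit_ops /=.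
by field.
Qed.

End Witness.

(** * The state and its inflation witness *)

(** As no regularity is imposed on inequalities, the indicator of incompatibility of the family is
    itself one. *)
Lemma witnessedP (R : realType) (G : network) (G' : inflation G)
    (h : vis G -> finType) (rho : op R (tbasis h)) :
  witnessed G' rho <->
  exists (I : finType) (Y : I -> expressible G'),
    ~ family_compatible (h := @copy_basis G G' h) (fun i => sigma rho (Y i)).
Proof.
split=> [[I [Y [F [FP F0]]]]|[I [Y ncomp]]].
  by exists I, Y => /FP; rewrite lt_geF.
exists I, Y, (fun fam => if `[< family_compatible fam >] then 0 else 1).
split=> [fam /asboolP -> //|].
by case: asboolP => // _; exact: ltr01.
Qed.

Definition hamming_weight (x : tbasis qubits) : nat := (x vA + x vB + x vC)%N.

(* This is 1/8 (I + 1/2 sum_(i < j) (X_i X_j + Y_i Y_j)). *)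
Definition weight_state (R : realType) : op R (tbasis qubits) :=
  mkop (fun x y => 8^-1 * (hamming_weight x == hamming_weight y)%:R).

(** Two strings of equal weight coincide or differ by exchanging a one and a zero at two sites,
    which is one raising and one lowering operator. *)
Lemma weight_stateE (R : realType) :
  weight_state R = expansion (@qubit_ops R) triangle_terms.
Proof.
have e8 : 2^-1 * (2^-1 * 2^-1) = 8^-1 :> R[i] by field.
apply: opP => x y; rewrite !coef_mkop !big_cons big_nil !big_I3.
rewrite /hamming_weight /qubit_ops /=.
case: (x vA); case: (y vA); case: (x vB); case: (y vB);
  case: (x vC); case: (y vC);
  by rewrite /= ?(mul0r, mulr0, mul1r, mulr1, addr0, add0r).
Qed.

Lemma weight_state_is_state (R : realType) : is_state (weight_state R).
Proof.
split.
  apply/psd_mkop; apply: psd_kernel_mul; last exact: psd_kernel_eqop.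
  have -> : (fun _ _ : tbasis qubits => 8^-1 : R[i]) =
      fun x y => (fun=> sqrtC 8^-1) x * ((fun=> sqrtC 8^-1) y)^*.
    apply/funext => x; apply/funext => y.
    by rewrite geC0_conj ?sqrtC_ge0 ?invr_ge0 ?ler0n // -expr2 sqrtCK.
  exact: psd_kernel_rank1.
rewrite mxtrace_coef; under eq_bigr => x _ do rewrite coef_mkop eqxx mulr1.
by rewrite sum_bits !big_bool /=; field.
Qed.

Lemma partial_trace_marginal (R : realType) (I J : finType) (h : I -> finType)
    (f : J -> I) (U : {set I}) (rho : op R (tbasis h)) (x y : tbasis h) :
  (forall i, (i \in codom f) = (i \in U)) ->
  partial_trace (coef rho) U x y =
  coef (marginal f rho) (reindex_tb f x) (reindex_tb f y).
Proof.
move=> fU; rewrite coef_marginal.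
have -> : [set i in codom f] = U by apply/setP => i; rewrite inE.
by apply: eq_bigl => z; apply: eq_forallb => i; rewrite fU.
Qed.

Lemma codom_val_set (T : finType) (U : {set T}) i :
  (i \in codom (fun a : {a : T | a \in U} => val a)) = (i \in U).
Proof.
apply/codomP/idP => [[a ->]|iU]; first exact: (valP a).
by exists (exist _ i iU).
Qed.

Lemma AB_injectable : injectable ([set vA; vB] : {set vis cut_inflation}).
Proof. by apply/cut_injectable; rewrite !inE. Qed.

Lemma BC_injectable : injectable ([set vB; vC] : {set vis cut_inflation}).
Proof. by apply/cut_injectable; rewrite !inE. Qed.

Definition cut_pairs (i : 'I_3) : expressible cut_inflation :=
  match val i with
  | 0 => injectable_expressible AB_injectable
  | 1 => injectable_expressible BC_injectable
  | _ => cut_AC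
  end.

Lemma expr_set_cut_pairs (U : {set 'I_3}) :
  U \in [:: [set vA; vB]; [set vB; vC]; [set vA; vC]] ->
  exists i, expr_set (cut_pairs i) = U.
Proof.
rewrite !inE => /or3P[] /eqP ->; [exists vA|exists vB|exists vC].
- exact: expr_set_injectable.
- exact: expr_set_injectable.
- exact: expr_set_cut_AC.
Qed.

(** The three pairs suffice: AB and BC are injectable, and AC is expressible as two singletons, so
    the inflated family has the marginals of [cut_terms]. *)
Lemma weight_state_witnessed (R : realType) :
  @witnessed R triangle cut_inflation qubits (weight_state R).
Proof.
apply/witnessedP; exists 'I_3, cut_pairs => -[tau [/compatible_psd/psdP tau_psd fam]].
apply: cut_marginals_not_psd tau_psd => U x y /expr_set_cut_pairs[i <-].
rewrite (partial_trace_marginal _ _ _ (codom_val_set (expr_set (cut_pairs i)))).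
have := fam i; rewrite weight_stateE (sigma_expansion (bits false false false));
  last first.
  exact: qubit_ops_trace.
move=> <-; rewrite (coef_marginal_expansion _ _ _ _ (@qubit_ops_trace R)).
congr (expansion_on _ _ _ _ _); apply/setP => j.
by rewrite inE codom_val_set.
Qed.

(** * Incompatibility with the triangle *)

Lemma reindex_mix_out (I J : finType) (h : I -> finType) (f : J -> I)
    (S : {set I}) (x y : tbasis h) :
  (forall j, f j \notin S) -> reindex_tb f (mix S x y) = reindex_tb f y.
Proof.
by move=> fS; apply: tbasisP => j; rewrite !reindex_tbE mixE (negPf (fS j)).
Qed.

Lemma partial_trace_expansion (R : realType) (h : 'I_3 -> finType)
    (q : forall i, option bool -> h i -> h i -> R[i]) ts U (x y : tbasis h) :
  (forall i t, \sum_k q i t k k = (t == None)%:R) ->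
  partial_trace (coef (expansion q ts)) U x y = expansion_on q ts U x y.
Proof.
move=> q_trace; rewrite (partial_trace_marginal _ _ _ (codom_val_set U)).
rewrite coef_marginal_expansion //; congr (expansion_on _ _ _ _ _).
by apply/setP => j; rewrite inE codom_val_set.
Qed.

(** * Partial trace of a source over one edge *)

Section EdgeTrace.
Variables (C : pzRingType) (I : finType) (k : I -> finType) (d : tbasis k).

Definition edge_trace (e : I) (K : tbasis k -> tbasis k -> C) (x y : tbasis k) : C :=
  \sum_(z | supp d [set e] z) K (mix [set e] z x) (mix [set e] z y).

Lemma sum_edge_trace (e : I) (H K : tbasis k -> tbasis k -> C) :
  (forall x y z z', H (mix [set e] z x) (mix [set e] z' y) = H x y) ->
  \sum_x \sum_y H x y * ((x e == y e)%:R * K x y) =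
  \sum_(x | supp d (~: [set e]) x) \sum_(y | supp d (~: [set e]) y)
    H x y * edge_trace e K x y.
Proof.
move=> Hdep; rewrite (sum_mixC d [set e]) exchange_big; apply: eq_bigr => x _ /=.
under eq_bigr => z _ do rewrite (sum_mixC d [set e]) exchange_big /=.
rewrite exchange_big; apply: eq_bigr => y _ /=.
rewrite mulr_sumr; apply: eq_bigr => z zd.
rewrite (bigD1 z) //= big1 ?addr0 => [|z' /andP[/suppP z'd z'z]].
  by rewrite Hdep !mixE inE eqxx eqxx mul1r.
rewrite !mixE inE eqxx; case: eqP => [zz'|_]; last by rewrite mul0r mulr0.
case/eqP: z'z; apply: tbasisP => i.
have [->//|ie] := eqVneq i e.
by rewrite z'd ?inE // (suppP _ _ _ zd) ?inE.
Qed.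

(** When the receiver at [e] is traced out, its channel leaves the factor [x e == y e]; if nothing
    else reads [e], the source enters only through its partial trace over [e]. *)
Lemma eq_sum_edge_trace (e : I) (H K K' : tbasis k -> tbasis k -> C) :
  (forall x y z z', H (mix [set e] z x) (mix [set e] z' y) = H x y) ->
  (forall x y, edge_trace e K x y = edge_trace e K' x y) ->
  \sum_x \sum_y H x y * ((x e == y e)%:R * K x y) =
  \sum_x \sum_y H x y * ((x e == y e)%:R * K' x y).
Proof.
move=> Hdep KK'; rewrite !sum_edge_trace //.
by apply: eq_bigr => x _; apply: eq_bigr => y _; rewrite KK'.
Qed.

End EdgeTrace.

Lemma edge_trace_psd (R : realType) (I : finType) (k : I -> finType)
    (d : tbasis k) (e : I) (K : tbasis k -> tbasis k -> R[i]) :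
  psd_kernel K -> psd_kernel (edge_trace d e K).
Proof.
move=> p; apply: psd_kernel_sum => z _.
exact: (psd_kernel_comp (fun x => mix [set e] z x) p).
Qed.

(* The edges from the latent vB, which feeds vA and vC. *)
Definition edge_BA : edges triangle :=
  exist (fun e : 'I_3 * 'I_3 => e.1 != e.2) (vB, vA) isT.
Definition edge_BC : edges triangle :=
  exist (fun e : 'I_3 * 'I_3 => e.1 != e.2) (vB, vC) isT.

(** * Cutting the source shared by A and C in a realisation on the triangle *)

Section Triangle.
Variables (R : realType) (k : edges triangle -> finType).
Variable rhoL : forall L, op R (tbasis (fun A => k (@edge_to_child triangle L A))).
Variable E : forall A,
  {linear op R (tbasis (fun L => k (@edge_from_parent triangle A L))) -> op R bool}.
Hypothesis rhoL_state : forall L, is_state (rhoL L).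
Hypothesis E_channel : forall A, is_channel (E A).
Variable d : tbasis k.

Let src L (x y : tbasis k) : R[i] :=
  coef (rhoL L) (reindex_tb (@edge_to_child triangle L) x)
                (reindex_tb (@edge_to_child triangle L) y).

Let chan A (x y : tbasis k) (s t : bool) : R[i] :=
  coef (E A (ketbra R (reindex_tb (@edge_from_parent triangle A) x)
                      (reindex_tb (@edge_from_parent triangle A) y))) s t.

(** The visible operator obtained when the source [vB] is replaced by the kernel [K]. *)
Let out (K : tbasis k -> tbasis k -> R[i]) : op R (tbasis qubits) :=
  tensor_map (fun A (x : tbasis k) => reindex_tb (@edge_from_parent triangle A) x)
    (fun A (s : tbasis qubits) => s A) (fun A => E A)
    (mkop (fun x y => src vA x y * src vC x y * K x y)).

Let coef_out K s t : coef (out K) s t = \sum_x \sum_y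
  src vA x y * src vC x y * K x y *
  (chan vA x y (s vA) (t vA) * (chan vB x y (s vB) (t vB) * chan vC x y (s vC) (t vC))).
Proof.
rewrite coef_tensor_map; apply: eq_bigr => x _; apply: eq_bigr => y _.
by rewrite coef_mkop big_I3.
Qed.

(** By trace preservation the traced output is the trace of a matrix unit on the edges into [A]. *)
Let chan_trace A x y : chan A x y false false + chan A x y true true =
  [forall e : edges triangle, ((val e).2 == A) ==> (x e == y e)]%:R.
Proof.
have [_ tp] := E_channel A.
have := tp (ketbra R (reindex_tb (@edge_from_parent triangle A) x)
                     (reindex_tb (@edge_from_parent triangle A) y)).
rewrite !mxtrace_coef big_bool addrC => /= ->.
under eq_bigr => u _ do rewrite coef_ketbra.
rewrite (bigD1 (reindex_tb (@edge_from_parent triangle A) x)) //= big1; last first.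
  by move=> u /negPf ->.
rewrite eqxx addr0 reindex_tb_eq; congr (_%:R); congr nat_of_bool.
apply: eq_forallb => -[[L B] LB] /=; congr (_ ==> _).
apply/codomP/eqP => [[l]|BA]; first by move=> /(congr1 val) [].
rewrite BA in LB *.
by exists (exist _ L LB); apply: val_inj.
Qed.

(* alpha and gamma are the two marginals of the source vB, and cut_src replaces
   that source by their product. *)
Let alpha := edge_trace d edge_BC (src vB).
Let gamma := edge_trace d edge_BA (src vB).
Let cut_src (x y : tbasis k) := alpha x y * gamma x y.

Let src_B_trace : \sum_(x | supp d [set edge_BA; edge_BC] x) src vB x x = 1.
Proof.
have [_ <-] := rhoL_state vB; rewrite mxtrace_coef.
rewrite (@sum_reindex_tb _ _ _ k (@edge_to_child triangle vB) d); last first.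
  by move=> A A' /(congr1 val) [] /val_inj.
apply: eq_bigl => x; congr (supp d _ x); apply/setP => -[[L A] LA].
rewrite !inE -!val_eqE /=.
apply/idP/codomP => [/orP[]/eqP[eL eA]|[B /(congr1 val) [-> ->]]].
- by exists (exist _ vA isT); apply: val_inj; rewrite /= eL eA.
- by exists (exist _ vC isT); apply: val_inj; rewrite /= eL eA.
by case: B => /=; apply: I3P.
Qed.

Let edges_B (e : edges triangle) : (val e).1 = vB -> e = edge_BA \/ e = edge_BC.
Proof.
case: e => -[L A] LA /= eL; rewrite {}eL in LA *.
move: A LA; apply: I3P => // LA; [left|right]; exact: val_inj.
Qed.

Let src_B_eq (x x' y y' : tbasis k) :
  (forall e : edges triangle, (val e).1 = vB -> x e = x' e /\ y e = y' e) ->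
  src vB x y = src vB x' y'.
Proof.
move=> H; rewrite /src; congr (coef _ _ _); apply: tbasisP => A;
  by rewrite !reindex_tbE; have [ex ey] := H (edge_to_child A) erefl; rewrite ?ex ?ey.
Qed.

Let mix1 (e : edges triangle) (z x : tbasis k) : mix [set e] z x e = z e.
Proof. by rewrite mixE inE eqxx. Qed.

Let mix1_neq (e e' : edges triangle) (z x : tbasis k) :
  e' != e -> mix [set e] z x e' = x e'.
Proof. by move=> ne; rewrite mixE inE (negPf ne). Qed.

Let alphaE (x x' y y' : tbasis k) : x edge_BA = x' edge_BA -> y edge_BA = y' edge_BA ->
  alpha x y = alpha x' y'.
Proof.
move=> ex ey; apply: eq_bigr => z _; apply: src_B_eq => e /edges_B[] ->.
  by rewrite !mix1_neq.
by rewrite !mix1.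
Qed.

Let gammaE (x x' y y' : tbasis k) : x edge_BC = x' edge_BC -> y edge_BC = y' edge_BC ->
  gamma x y = gamma x' y'.
Proof.
move=> ex ey; apply: eq_bigr => z _; apply: src_B_eq => e /edges_B[] ->.
  by rewrite !mix1.
by rewrite !mix1_neq.
Qed.

Let disjoint_BA_BC : [disjoint [set edge_BA] & [set edge_BC]].
Proof. by rewrite disjoints1 inE. Qed.

Let alpha_trace : \sum_(z | supp d [set edge_BA] z) alpha z z = 1.
Proof.
rewrite -src_B_trace (sum_mix _ _ disjoint_BA_BC); apply: eq_bigr => z _; apply: eq_bigr => z' _.
by apply: src_B_eq => e /edges_B[] ->; rewrite !(mix1, mix1_neq).
Qed.

Let gamma_trace : \sum_(z | supp d [set edge_BC] z) gamma z z = 1.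
Proof.
rewrite -src_B_trace (sum_mix _ _ disjoint_BA_BC) exchange_big; apply: eq_bigr => z _.
by apply: eq_bigr => z' _.
Qed.

(** Tracing [cut_src] over one edge leaves one factor of the product times the trace of the other,
    which is 1. *)
Let cut_src_BC x y : edge_trace d edge_BC (src vB) x y = edge_trace d edge_BC cut_src x y.
Proof.
rewrite -[LHS]mulr1 -gamma_trace mulr_sumr; apply: eq_bigr => z _.
by congr (_ * _); [apply: alphaE|apply: gammaE]; rewrite ?mix1 ?mix1_neq.
Qed.

Let cut_src_BA x y : edge_trace d edge_BA (src vB) x y = edge_trace d edge_BA cut_src x y.
Proof.
rewrite -[LHS]mul1r -alpha_trace mulr_suml; apply: eq_bigr => z _.
by congr (_ * _); [apply: alphaE|apply: gammaE]; rewrite ?mix1 ?mix1_neq.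
Qed.

Let src_mix L e z z' x y : (val e).1 != L ->
  src L (mix [set e] z x) (mix [set e] z' y) = src L x y.
Proof.
move=> eL; rewrite /src !reindex_mix_out // => A; rewrite inE;
  by apply: contraNneq eL => <-.
Qed.

Let chan_mix A e z z' x y s t : (val e).2 != A ->
  chan A (mix [set e] z x) (mix [set e] z' y) s t = chan A x y s t.
Proof.
move=> eA; rewrite /chan !reindex_mix_out // => L; rewrite inE;
  by apply: contraNneq eA => <-.
Qed.

Let other_edges A e0 (x y : tbasis k) :=
  [forall e : edges triangle, ((val e).2 == A) && (e != e0) ==> (x e == y e)].

Let chan_trace_edge A e0 (x y : tbasis k) : (val e0).2 = A ->
  chan A x y false false + chan A x y true true =
  (other_edges A e0 x y)%:R * (x e0 == y e0)%:R.
Proof.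
move=> e0A; rewrite chan_trace -natrM mulnb; congr (_%:R); congr nat_of_bool.
apply/forallP/andP => [H|[/forallP H xy] e].
  split; last by have := H e0; rewrite e0A eqxx.
  by apply/forallP => e; apply/implyP => /andP[eA _]; have := H e; rewrite eA.
apply/implyP => eA; have [->//|ne] := eqVneq e e0.
by have := H e; rewrite eA ne.
Qed.

Let other_edges_mix A e0 z z' x y :
  other_edges A e0 (mix [set e0] z x) (mix [set e0] z' y) = other_edges A e0 x y.
Proof.
apply: eq_forallb => e; have [->|ne] := eqVneq e e0; first by rewrite andbF.
by rewrite !mix1_neq.
Qed.

Let cut_AB a b a' b' c c' :
  partial_trace (coef (out cut_src)) [set vA; vB] (bits a b c) (bits a' b' c') =
  partial_trace (coef (out (src vB))) [set vA; vB] (bits a b c) (bits a' b' c').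
Proof.
(* With C traced out, its channel reduces to indicators on its incoming edges; [H] collects all
   factors that do not read [edge_BC]. *)
pose H x y := src vA x y * src vC x y * chan vA x y a a' * chan vB x y b b' *
  (other_edges vC edge_BC x y)%:R.
have outE K : partial_trace (coef (out K)) [set vA; vB] (bits a b c) (bits a' b' c') =
    \sum_x \sum_y H x y * ((x edge_BC == y edge_BC)%:R * K x y).
  rewrite partial_trace_AB !coef_out -big_split /=; apply: eq_bigr => x _.
  rewrite -big_split /=; apply: eq_bigr => y _; rewrite !bitsE.
  transitivity (src vA x y * src vC x y * K x y * (chan vA x y a a' * chan vB x y b b') *
    (chan vC x y false false + chan vC x y true true)); first by ring.
  by rewrite (chan_trace_edge (e0 := edge_BC)) // /H; ring.
rewrite !outE; symmetry; apply: eq_sum_edge_trace cut_src_BC => x y z z'.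
by rewrite /H !src_mix // !chan_mix // other_edges_mix.
Qed.

Let cut_BC a b a' b' c c' :
  partial_trace (coef (out cut_src)) [set vB; vC] (bits c a b) (bits c' a' b') =
  partial_trace (coef (out (src vB))) [set vB; vC] (bits c a b) (bits c' a' b').
Proof.
pose H x y := src vA x y * src vC x y * chan vB x y a a' * chan vC x y b b' *
  (other_edges vA edge_BA x y)%:R.
have outE K : partial_trace (coef (out K)) [set vB; vC] (bits c a b) (bits c' a' b') =
    \sum_x \sum_y H x y * ((x edge_BA == y edge_BA)%:R * K x y).
  rewrite partial_trace_BC !coef_out -big_split /=; apply: eq_bigr => x _.
  rewrite -big_split /=; apply: eq_bigr => y _; rewrite !bitsE.
  transitivity (src vA x y * src vC x y * K x y * (chan vB x y a a' * chan vC x y b b') *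
    (chan vA x y false false + chan vA x y true true)); first by ring.
  by rewrite (chan_trace_edge (e0 := edge_BA)) // /H; ring.
rewrite !outE; symmetry; apply: eq_sum_edge_trace cut_src_BA => x y z z'.
by rewrite /H !src_mix // !chan_mix // other_edges_mix.
Qed.

(** With the source [vB] cut and B traced out, the network falls into two pieces. The piece of A
    consists of both edges from the latent [vC] and of [edge_BA]; the other three edges form the
    piece of C. *)
Let side_A : {set edges triangle} :=
  [set e | ((val e).1 == vC) || ((val e).2 == vA)].

Let side_edges (b : bool) (x y : tbasis k) := [forall e : edges triangle,
  ((val e).2 == vB) && ((e \in side_A) == b) ==> (x e == y e)].

Let cut_AC : exists f g : bool -> bool -> R[i], forall a b a' b' c c',
  partial_trace (coef (out cut_src)) [set vA; vC] (bits a c b) (bits a' c' b') =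
  f a a' * g b b'.
Proof.
(* [F] reads only the edges in [side_A] and [G] only the others, so the sum over edge labels
   factors. *)
pose F a a' x y := src vC x y * alpha x y * chan vA x y a a' * (side_edges true x y)%:R.
pose G b b' x y := src vA x y * gamma x y * chan vC x y b b' * (side_edges false x y)%:R.
exists (fun a a' => \sum_(z | supp d side_A z) \sum_(u | supp d side_A u) F a a' z u).
exists (fun b b' => \sum_(z | supp d (~: side_A) z)
                     \sum_(u | supp d (~: side_A) u) G b b' z u).
move=> a b a' b' c c'; rewrite partial_trace_AC !coef_out -big_split /=.
transitivity (\sum_x \sum_y F a a' x y * G b b' x y).
  apply: eq_bigr => x _; rewrite -big_split /=; apply: eq_bigr => y _; rewrite !bitsE.
  transitivity (src vA x y * src vC x y * cut_src x y *
    (chan vA x y a a' * chan vC x y b b') *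
    (chan vB x y false false + chan vB x y true true)); first by ring.
  have -> : chan vB x y false false + chan vB x y true true =
      (side_edges true x y)%:R * (side_edges false x y)%:R.
    rewrite chan_trace -natrM mulnb; congr (_%:R); congr nat_of_bool.
    apply/forallP/andP => [H|[/forallP Ht /forallP Hf] e].
      by split; apply/forallP => e; apply/implyP => /andP[eB _];
        have := H e; rewrite eB.
    apply/implyP => eB; case eS: (e \in side_A).
      by have := Ht e; rewrite eB eS.
    by have := Hf e; rewrite eB eS.
  by rewrite /F /G /cut_src; ring.
have srcS L (x x' y y' : tbasis k) : (forall e : edges triangle, (val e).1 = L ->
    x e = x' e /\ y e = y' e) -> src L x y = src L x' y'.
  move=> H; rewrite /src; congr (coef _ _ _); apply: tbasisP => A;
  by rewrite !reindex_tbE; have [ex ey] := H (edge_to_child A) erefl; rewrite ?ex ?ey.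
have chanS A (x x' y y' : tbasis k) s t : (forall e : edges triangle, (val e).2 = A ->
    x e = x' e /\ y e = y' e) -> chan A x y s t = chan A x' y' s t.
  move=> H; rewrite /chan; congr (coef (E A (ketbra R _ _)) s t); apply: tbasisP => L;
  by rewrite !reindex_tbE; have [ex ey] := H (edge_from_parent L) erefl; rewrite ?ex ?ey.
have FE z z' u u' : F a a' (mix side_A z z') (mix side_A u u') = F a a' z u.
  rewrite /F; congr (_ * _ * _ * (nat_of_bool _)%:R).
  - by apply: srcS => e eC; rewrite !mixE inE eC eqxx.
  - by apply: alphaE; rewrite mixE inE.
  - by apply: chanS => e eA; rewrite !mixE inE eA eqxx orbT.
  by apply: eq_forallb => e; rewrite !mixE; case: (e \in side_A); rewrite ?andbF.
have GE z z' u u' : G b b' (mix side_A z z') (mix side_A u u') = G b b' z' u'.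
  rewrite /G; congr (_ * _ * _ * (nat_of_bool _)%:R).
  - apply: srcS => e eA; have /negPf := valP e; rewrite eA => /= e2.
    by rewrite !mixE inE eA /= eq_sym e2.
  - by apply: gammaE; rewrite mixE inE.
  - apply: chanS => e eC; have /negPf := valP e; rewrite eC => /= e1.
    by rewrite !mixE inE eC e1.
  by apply: eq_forallb => e; rewrite !mixE; case: (e \in side_A); rewrite ?andbF.
rewrite (sum_mixC d side_A) mulr_suml; apply: eq_bigr => z _.
transitivity (\sum_(z' | supp d (~: side_A) z') \sum_(u | supp d side_A u)
    \sum_(u' | supp d (~: side_A) u') F a a' z u * G b b' z' u').
  apply: eq_bigr => z' _; rewrite (sum_mixC d side_A); apply: eq_bigr => u _.
  by apply: eq_bigr => u' _; rewrite FE GE.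
rewrite exchange_big mulr_suml; apply: eq_bigr => u _ /=.
rewrite mulr_sumr; apply: eq_bigr => z' _.
by rewrite mulr_sumr; apply: eq_bigr => u' _.
Qed.

Lemma cut_source_absurd : out (src vB) <> weight_state R.
Proof.
move=> rhoE.
have cut_psd : psd_kernel (coef (out cut_src)).
  apply/psdP/tensor_map_psd => [A|]; first by case: (E_channel A).
  have src_psd L : psd_kernel (src L).
    by apply: psd_kernel_comp; apply/psdP; case: (rhoL_state L).
  apply/psd_mkop/psd_kernel_mul; first exact: psd_kernel_mul.
  by apply: psd_kernel_mul; exact: edge_trace_psd.
have margE (U : {set 'I_3}) (x y : tbasis qubits) :
    ~~ ((vA \in U) && (vC \in U)) ->
    partial_trace (coef (out (src vB))) U x y =
    expansion_on (@qubit_ops R) cut_terms U x y.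
  move=> UAC; rewrite rhoE weight_stateE partial_trace_expansion;
    last exact: qubit_ops_trace.
  exact: expansion_on_cut.
have ABE (x y : tbasis qubits) : partial_trace (coef (out cut_src)) [set vA; vB] x y =
    expansion_on (@qubit_ops R) cut_terms [set vA; vB] x y.
  by rewrite -(bits_eta x) -(bits_eta y) cut_AB margE // !inE.
have BCE (x y : tbasis qubits) : partial_trace (coef (out cut_src)) [set vB; vC] x y =
    expansion_on (@qubit_ops R) cut_terms [set vB; vC] x y.
  by rewrite -(bits_eta x) -(bits_eta y) cut_BC margE // !inE.
apply: cut_marginals_not_psd cut_psd => U x y; rewrite !inE => /or3P[] /eqP-> //.
have [f [g fg]] := cut_AC.
pose PT := partial_trace (coef (out cut_src)).
(* Only the product of [f] and [g] is known. Each times the trace of the other is a one-body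
   marginal, already contained in the AB or BC marginal, and equals half the identity. *)
have fE a a' : f a a' * (g false false + g true true) = (a == a')%:R / 2.
  transitivity (PT [set vA; vB] (bits a false false) (bits a' false false) +
                PT [set vA; vB] (bits a true false) (bits a' true false)).
    rewrite mulrDr -!(fg _ _ _ _ false false) /PT.
    by rewrite !partial_trace_AC !partial_trace_AB; ring.
  rewrite /PT !ABE /expansion_on !big_cons !big_nil !big_I3 /= !inE /= !bitsE /qubit_ops /=.
  by field.
have gE b b' : (f false false + f true true) * g b b' = (b == b')%:R / 2.
  transitivity (PT [set vB; vC] (bits false false b) (bits false false b') +
                PT [set vB; vC] (bits false true b) (bits false true b')).
    rewrite mulrDl -!(fg _ _ _ _ false false) /PT.
    by rewrite !partial_trace_AC !partial_trace_BC; ring.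
  rewrite /PT !BCE /expansion_on !big_cons !big_nil !big_I3 /= !inE /= !bitsE /qubit_ops /=.
  by field.
have fg1 : (f false false + f true true) * (g false false + g true true) = 1.
  by rewrite mulrDl !fE /=; field.
rewrite -(bits_eta x) -(bits_eta y) fg -[LHS]mulr1 -fg1.
transitivity ((f (x vA) (y vA) * (g false false + g true true)) *
  ((f false false + f true true) * g (x vC) (y vC))); first by ring.
rewrite fE gE expansion_on_cut_product ?inE // big_I3 !inE /= !bitsE mul1r.
by [].
Qed.

End Triangle.

Lemma weight_state_incompatible (R : realType) :
  ~ @compatible R triangle qubits (weight_state R).
Proof.
move=> [k [rhoL [E [Ls Ec rhoE]]]].
(* If some edge carries an empty basis, the output is the zero operator, which does not have trace
   one. *)
have [d _|k0] := pickP (predT : pred (tbasis k)); last first.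
  have [_ tr1] := weight_state_is_state R; have /eqP[] := oner_neq0 R[i].
  rewrite -tr1 rhoE (_ : tensor_map _ _ _ _ = 0) ?mxtrace0 //.
  by apply: big1 => x; have := k0 x.
apply: (cut_source_absurd Ls Ec d); rewrite rhoE; congr tensor_map.
apply: opP => x y; rewrite !coef_mkop big_I3.
by rewrite /= mulrAC mulrA.
Qed.

(** * Local measurements *)

Section Measurement.
Variables (R : realType) (o : 'I_3 -> finType).
Variable E : forall A : 'I_3, o A -> op R bool.
Hypothesis povm : forall A, is_povm (@E A).

(** The trace of the effect [E k] against a local factor: for [None] the probability of [k] in the
    maximally mixed state, otherwise half an off-diagonal entry of the effect. *)
Definition outcome_term (i : 'I_3) (t : option bool) (k : o i) : R[i] :=
  \sum_a \sum_b coef (E k) a b * qubit_op R t b a.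

Definition outcome_ops (i : 'I_3) (t : option bool) (k l : o i) : R[i] :=
  (k == l)%:R * outcome_term t k.

(** Local measurements act on each product term factor by factor, so the list [ts] is preserved. *)
Lemma outcome_prob_expansion ts :
  diagonal_state (@outcome_prob R triangle qubits o E (expansion (@qubit_ops R) ts)) =
  expansion outcome_ops ts.
Proof.
apply: opP => s t; rewrite !coef_mkop.
transitivity ((s == t)%:R *
    \sum_(u <- ts) \prod_(i : 'I_3) outcome_term (nth None u i) (s i)); last first.
  rewrite mulr_sumr; apply: eq_bigr => u _.
  by rewrite dffun_eqE -prod_coef_forall.
case: eqP => _; rewrite ?mul0r // mul1r.
rewrite /outcome_prob mxtrace_mul_coef.
transitivity (\sum_(x : tbasis qubits) \sum_(y : tbasis qubits) \sum_(u <- ts)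
   \prod_(i : 'I_3) (coef (E (s i)) (x i) (y i) * qubit_op R (nth None u i) (y i) (x i))).
  apply: eq_bigr => x _; apply: eq_bigr => y _.
  rewrite !coef_mkop mulr_sumr; apply: eq_bigr => u _.
  by rewrite -big_split.
under eq_bigr => x _ do rewrite exchange_big /=.
rewrite exchange_big /=; apply: eq_bigr => u _.
by rewrite (sum2_dffun_prod (h := qubits) (fun (i : 'I_3) a b =>
  coef (E (s i)) a b * qubit_op R (nth None u i) b a)).
Qed.

Lemma outcome_term_trace i t : \sum_k @outcome_term i t k = (t == None)%:R.
Proof.
have sumE a b : \sum_k coef (@E i k) a b = (a == b)%:R.
  by rewrite -op_coef_sum (povm i).2 /coef mxE (inj_eq enum_rank_inj).
rewrite exchange_big -(@qubit_ops_trace R i t); apply: eq_bigr => a _ /=.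
rewrite exchange_big /=; under eq_bigr => b _ do rewrite -mulr_suml sumE.
rewrite (bigD1 a) //= big1 ?addr0 => [|b /negPf ba]; first by rewrite eqxx mul1r.
by rewrite eq_sym ba mul0r.
Qed.

Lemma outcome_ops_trace i t : \sum_k @outcome_ops i t k k = (t == None)%:R.
Proof.
rewrite -(@outcome_term_trace i t); apply: eq_bigr => k _.
by rewrite /outcome_ops eqxx mul1r.
Qed.

Local Notation p k := (outcome_term None k).
Local Notation w k := (outcome_term (Some true) k).
Local Notation w' k := (outcome_term (Some false) k).

Lemma outcome_NoneE i (k : o i) :
  p k = (coef (E k) false false + coef (E k) true true) / 2.
Proof. by rewrite /outcome_term !big_bool /=; field. Qed.

Lemma outcome_trueE i (k : o i) : w k = coef (E k) false true / 2.
Proof. by rewrite /outcome_term !big_bool /=; field. Qed.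

Lemma outcome_falseE i (k : o i) : w' k = coef (E k) true false / 2.
Proof. by rewrite /outcome_term !big_bool /=; field. Qed.

Lemma outcome_psd i (k : o i) : psd_kernel (coef (E k)).
Proof. by apply/psdP; case: (povm i) => + _. Qed.

Lemma outcome_conj i (k : o i) : w' k = (w k)^*.
Proof.
rewrite outcome_falseE outcome_trueE rmorphM /= fmorphV /= conjC_nat.
by rewrite -(psd_kernel_herm false true (outcome_psd k)).
Qed.

Lemma outcome_ge0 i (k : o i) : 0 <= p k.
Proof.
rewrite outcome_NoneE mulr_ge0 ?invr_ge0 ?ler0n // addr_ge0 //;
  exact: psd_kernel_diag (outcome_psd k).
Qed.

Lemma outcome_norm i (k : o i) : `|w k| <= p k / 2.
Proof.
rewrite outcome_trueE outcome_NoneE normrM [`|2^-1|]ger0_norm ?invr_ge0 ?ler0n //.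
rewrite ler_wpM2r ?invr_ge0 ?ler0n //.
set z := coef (E k) false true.
have pk := outcome_psd k.
have [->|z0] := eqVneq z 0.
  rewrite normr0 mulr_ge0 ?invr_ge0 ?ler0n // addr_ge0 //; exact: psd_kernel_diag.
have nz0 : `|z| != 0 by rewrite normr_eq0.
(* The phase of the second entry makes the two cross terms add up to minus twice the modulus of
   [z]. *)
have := @psd_kernel2 R _ _ false true 1 (- z^* / `|z|) pk isT.
rewrite (psd_kernel_herm false true pk) -/z.
rewrite conjC1 !rmorphM /= rmorphN /= conjCK fmorphV /= (conj_Creal (normr_real z)).
have zz : z * z^* = `|z| ^+ 2 by rewrite normCK.
have -> : 1 * coef (E k) false false * 1 + 1 * z * (- z^* / `|z|) +
  (- z / `|z| * z^* * 1 + - z / `|z| * coef (E k) true true * (- z^* / `|z|)) =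
  coef (E k) false false + coef (E k) true true * ((z * z^*) / `|z| ^+ 2)
    - (z * z^* / `|z|) * 2 by field.
rewrite zz divff ?expf_neq0 // mulr1 expr2 mulfK // subr_ge0 => H.
by rewrite ler_pdivlMr ?ltr0n.
Qed.

Lemma real_part_ge (C : numClosedFieldType) (x : C) : - (`|x| * 2) <= x + x^*.
Proof.
have xr : x + x^* \is Num.real.
  by apply/CrealP; rewrite rmorphD /= conjCK addrC.
have : `|x + x^*| <= `|x| * 2.
  by rewrite (le_trans (ler_normD _ _)) // norm_conjC mulr_natr mulr2n.
by rewrite real_ler_norml // => /andP[].
Qed.

(* At p k = 0 the quotient is 0, and so is w k by outcome_norm. *)
Lemma outcome_ratio i (k : o i) : p k * (w k / p k) = w k.
Proof.
have [p0|pn0] := eqVneq (p k) 0; last by rewrite mulrCA divff ?mulr1.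
have := outcome_norm k; rewrite p0 !mul0r normr_le0 => /eqP ->.
by [].
Qed.

Lemma outcome_ratio' i (k : o i) : p k * (w' k / p k) = w' k.
Proof.
have [p0|pn0] := eqVneq (p k) 0; last by rewrite mulrCA divff ?mulr1.
have := outcome_norm k; rewrite outcome_conj p0 !mul0r normr_le0 => /eqP ->.
by rewrite conjC0.
Qed.

Lemma outcome_ratio_conj i (k : o i) : w' k / p k = (w k / p k)^*.
Proof.
by rewrite rmorphM /= fmorphV /= outcome_conj (geC0_conj (outcome_ge0 k)).
Qed.

Lemma outcome_ratio_norm i (k : o i) : `|w k / p k| <= 2^-1.
Proof.
rewrite normrM normfV (ger0_norm (outcome_ge0 k)).
have := outcome_ge0 k; rewrite le_eqVlt => /predU1P[<-|pk0].
  by rewrite invr0 mulr0 invr_ge0 ler0n.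
by rewrite ler_pdivrMr // mulrC outcome_norm.
Qed.

(* The conditional probability of the outcome k of B, given the outcomes x of A
   and y of C. *)
Let response (x : o vA) (y : o vC) i (k : o i) : R[i] :=
  p k + (w x / p x * w' k + w' x / p x * w k) + (w k * (w' y / p y) + w' k * (w y / p y)).

(** The ratios have modulus at most 1/2 and [w' k] at most half of [p k], so each of the two
    brackets is at least minus half of [p k]. *)
Lemma response_ge0 x y i (k : o i) : 0 <= response x y k.
Proof.
pose a := w x / p x * w' k; pose c := w' k * (w y / p y).
have aE : w' x / p x * w k = a^*.
  by rewrite /a rmorphM /= outcome_ratio_conj (outcome_conj k) conjCK.
have cE : w k * (w' y / p y) = c^*.
  by rewrite /c rmorphM /= outcome_ratio_conj (outcome_conj k) conjCK.
have w'n : `|w' k| <= p k / 2 by rewrite outcome_conj norm_conjC outcome_norm.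
have bound z : `|z| <= 2^-1 * (p k / 2) -> - (p k / 2) <= z + z^*.
  move=> zb; apply: le_trans (real_part_ge z); rewrite lerN2.
  rewrite -ler_pdivlMr ?ltr0n // (le_trans zb) // mulrC lexx //.
rewrite /response aE cE [c^* + c]addrC -/a -/c.
have ha : - (p k / 2) <= a + a^*.
  by apply: bound; rewrite normrM ler_pM ?outcome_ratio_norm.
have hc : - (p k / 2) <= c + c^*.
  by apply: bound; rewrite normrM mulrC ler_pM ?outcome_ratio_norm.
have -> : p k + (a + a^*) + (c + c^*) = (p k / 2 + (a + a^*)) + (p k / 2 + (c + c^*)).
  by field.
by rewrite addr_ge0 // addrC -lerBlDr sub0r.
Qed.

Lemma response_sum x y i : \sum_(k : o i) response x y k = 1.
Proof.
rewrite !big_split /= -!mulr_sumr -!mulr_suml !outcome_term_trace /=.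
by rewrite !mulr0 !mul0r !addr0.
Qed.

Lemma sum_outcome_marginal (s : tbasis o) j :
  \sum_(t : tbasis o) (\prod_i p (t i)) * (s j == t j)%:R = p (s j).
Proof.
transitivity (\sum_(t : tbasis o) \prod_i
    (p (t i) * (if i == j then (s i == t i)%:R else 1))).
  apply: eq_bigr => t _; rewrite big_split /=; congr (_ * _).
  by rewrite (bigD1 j) //= eqxx big1 ?mulr1 // => i /negPf ->.
rewrite (sum_dffun_prod (fun i k => p k * (if i == j then (s i == k)%:R else 1))).
rewrite (bigD1 j) //= eqxx [X in _ * X]big1 ?mulr1 => [|i /negPf ->].
  rewrite (bigD1 (s j)) //= eqxx mulr1 big1 ?addr0 // => k /negPf sk.
  by rewrite eq_sym sk mulr0.
by under eq_bigr => k _ do rewrite mulr1; rewrite outcome_term_trace.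
Qed.

(** The numbers [p k] sum to 1 at every site, so no outcome set is empty. *)
Lemma outcome_inhabited : exists d : tbasis o, true.
Proof.
have [d _|no] := pickP (predT : pred (tbasis o)); first by exists d.
have /eqP[] := oner_neq0 R[i].
transitivity (\prod_i \sum_k @outcome_term i None k).
  by rewrite big1 // => i _; rewrite outcome_term_trace.
by rewrite -sum_dffun_prod big1 // => t; have := no t.
Qed.

(** To have one alphabet, every latent draws a full outcome string from the product of the [p]. A
    outputs its entry of the string of [l2], C its entry of that of [l0], and B, which sees both,
    outputs according to [response]. *)
Lemma outcome_cut_compatible :
  @compatible R cut o (expansion outcome_ops cut_terms).
Proof.
have [d _] := outcome_inhabited.
pose l0 := @Ordinal 4 0 isT; pose l2 := @Ordinal 4 2 isT.
pose q (L : 'I_4) (t : tbasis o) : R[i] := \prod_i p (t i).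
pose r (i : 'I_3) (l : 'I_4 -> tbasis o) (k : o i) : R[i] :=
  if i == vA then (k == l l2 i)%:R else if i == vC then (k == l l0 i)%:R
  else response (l l2 vA) (l l0 vC) k.
have q1 L : \sum_t q L t = 1.
  rewrite /q (sum_dffun_prod (fun i k => p k)) big1 // => i _.
  exact: outcome_term_trace.
have delta_sum (i : 'I_3) (k : o i) : \sum_l (l == k)%:R = 1 :> R[i].
  by rewrite (bigD1 k) //= eqxx big1 ?addr0 // => l /negPf ->.
have := @classical_compatible R cut o (tbasis o) d q r.
rewrite [X in _ -> _ -> _ -> _ -> _ -> compatible X](_ : _ =
  expansion outcome_ops cut_terms).
  apply=> [L t|//|A l s|A l|A l l' ll' s].
  - by apply: prodr_ge0 => i _; exact: outcome_ge0.
  - by rewrite /r; do 2?[case: ifP => _; rewrite ?ler0n //]; exact: response_ge0.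
  - rewrite /r; case: (A == vA); first exact: delta_sum.
    case: (A == vC); first exact: delta_sum.
    exact: response_sum.
  rewrite /r; move: A s ll'; apply: I3P => s ll' /=.
  - by rewrite (ll' l2).
  - by rewrite (ll' l2) // (ll' l0).
  - by rewrite (ll' l0).
apply: opP => s t; rewrite !coef_mkop.
transitivity ((s == t)%:R *
    \sum_(u <- cut_terms) \prod_(i : 'I_3) outcome_term (nth None u i) (s i)); last first.
  rewrite mulr_sumr; apply: eq_bigr => u _.
  by rewrite dffun_eqE -prod_coef_forall.
case: eqP => _; rewrite ?mul0r // mul1r.
(* The deterministic responses of A and C are moved onto the latents they read, so that the sum over
   letters factors. *)
pose ind (L : 'I_4) (t : tbasis o) : R[i] :=
  if L == l2 then (s vA == t vA)%:R else if L == l0 then (s vC == t vC)%:R else 1.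
transitivity (response (s vA) (s vC) (s vB) *
    \sum_(l : {ffun 'I_4 -> tbasis o}) \prod_L (q L (l L) * ind L (l L))).
  rewrite mulr_sumr; apply: eq_bigr => l _.
  rewrite [in RHS]big_split /= mulrCA; congr (_ * _).
  rewrite big_I3 /r /= !big_ord_recl big_ord0 /ind /=.
  have -> : lift ord0 (lift ord0 ord0) = l2 by exact: val_inj.
  have -> : ord0 = l0 by exact: val_inj.
  case: (s vA =P l l2 vA) => [<-|_]; last by rewrite !(mul0r, mulr0).
  case: (s vC =P l l0 vC) => [<-|_]; last by rewrite !(mul0r, mulr0).
  by rewrite !(mul1r, mulr1).
rewrite -(bigA_distr_bigA (fun L t => q L t * ind L t)) /= !big_ord_recl big_ord0 /ind /=.
have -> : \sum_t q ord0 t * (s vC == t vC)%:R = p (s vC) by exact: sum_outcome_marginal.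
have -> L : \sum_t q L t * (s vA == t vA)%:R = p (s vA).
  exact: sum_outcome_marginal.
have q11 L : \sum_t q L t * 1 = 1 by under eq_bigr => t' _ do rewrite mulr1.
rewrite !q11 !big_cons !big_nil !big_I3 /= /response.
(* The probabilities of the outcomes of A and C cancel the denominators in [response], including
   where they are zero. *)
transitivity (p (s vA) * p (s vB) * p (s vC) +
  (p (s vA) * (w (s vA) / p (s vA))) * w' (s vB) * p (s vC) +
  (p (s vA) * (w' (s vA) / p (s vA))) * w (s vB) * p (s vC) +
  p (s vA) * w (s vB) * (p (s vC) * (w' (s vC) / p (s vC))) +
  p (s vA) * w' (s vB) * (p (s vC) * (w (s vC) / p (s vC)))); first by ring.
by rewrite !outcome_ratio !outcome_ratio'; ring.
Qed.

End Measurement.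

(** For any measurements, the inflated families of the outcome distribution are marginals of one
    table compatible with [cut], whatever expressible sets are chosen. *)
Lemma weight_state_not_distribution_witnessable (R : realType) :
  ~ @distribution_witnessable R triangle cut_inflation qubits (weight_state R).
Proof.
move=> [o [E [povm /witnessedP[I [Y []]]]]].
have [d _] := outcome_inhabited povm.
exists (expansion (outcome_ops E) cut_terms); split=> [|i].
  exact: outcome_cut_compatible.
rewrite weight_stateE outcome_prob_expansion.
by apply: sigma_expansion => // j t; exact: outcome_ops_trace.
Qed.

Theorem proposition3 (R : realType) :
  exists (G : network) (G' : inflation G) (h : vis G -> finType)
         (rho : op R (tbasis h)),
    nonfanout G' /\
    is_state rho /\
    ~ compatible rho /\
    witnessed G' rho /\
    ~ distribution_witnessable G' rho.
Proof.
exists triangle, cut_inflation, qubits, (weight_state R); split; last split.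
- by move=> L A B.
- exact: weight_state_is_state.
split; first exact: weight_state_incompatible.
split; first exact: weight_state_witnessed.
exact: weight_state_not_distribution_witnessable.
Qed.
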